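(* For $\nu>-1$ let $q_\nu:(0,\infty)\to(0,\infty)$ be defined by $$q_\nu(x)=\frac{I_{\nu}(x)K_{\nu}(x)}{1+|\ln x|}.$$ Then $q_{\nu}$ is increasing on $(0,1]$ for every $\nu\geq\frac{1}{2}$, and $q_\nu$ is decreasing on $[1,\infty)$ for every $\nu>-1$. Consequently, if $x\in(0,1]$ and $\nu\geq\frac{1}{2}$, then $$q_\nu(x)\leq q_\nu(1)=I_\nu(1)K_\nu(1).$$ Moreover, for $x\geq 1$ this inequality is valid for all $\nu>-1$.
   Context: $I_\nu$ and $K_\nu$ denote the modified Bessel functions of the first and second kind of order $\nu$. *)

(* Defs.v *)
From Stdlib Require Import Reals Factorial ClassicalEpsilon.
From Coquelicot Require Import Coquelicot.
Open Scope R_scope.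

(** The reciprocal gamma function [1/Gamma(z)], by the Euler-Gauss product
    [1/Gamma(z) = lim z (z+1) ... (z+n) / (n! n^z)].  The limit exists for every
    real [z] and is [0] at the poles [0, -1, -2, ...] of [Gamma], so that
    [BesselI] below is meaningful for every real order. *)
Definition rGamma (z : R) : R :=
  real (Lim_seq (fun n : nat =>
    prod_f_R0 (fun k => z + INR k) n / (INR (fact n) * Rpower (INR n) z))).

(** Intended for [0 < x]; [Rpower] is the real power of a positive base. *)
Definition BesselI (nu x : R) : R :=
  Series (fun k : nat =>
    Rpower (x / 2) (2 * INR k + nu) * rGamma (nu + INR k + 1) / INR (fact k)).

Definition BesselK_quot (x nu : R) : R :=
  PI / 2 * ((BesselI (- nu) x - BesselI nu x) / sin (nu * PI)).

(** The classical definition: the quotient is replaced by its limiting value in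
    the order when the order is an integer. *)
Definition BesselK (nu x : R) : R :=
  if excluded_middle_informative (exists m : Z, nu = IZR m)
  then real (Lim (BesselK_quot x) nu)
  else BesselK_quot x nu.

Definition q (nu x : R) : R :=
  BesselI nu x * BesselK nu x / (1 + Rabs (ln x)).

(* Main.v *)
Require Import Defs.
From Stdlib Require Import Reals ZArith Factorial Lra Lia Psatz ClassicalEpsilon.
From Coquelicot Require Import Coquelicot.
Open Scope R_scope.

(** Write [I], [J] and [K] for the Bessel functions [I_nu], [I_(nu+1)] and [K_nu],
    and [w = x I' = nu I + x J].  Up to a positive constant, [K = I * rho] where
    [rho' = - 1 / (x I^2)] and [rho] tends to 0 at infinity.  Comparing
    derivatives with those of explicit functions of [I] and [w] gives, for
    [nu >= 0] and [s >= max (nu, 1/2)],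
      [1 / (I (w + (x + s) I)) <= rho <= 1 / (2 w I)].
    The upper bound says that [I K] is nonincreasing, the lower one that
    [exp x * I K] is nondecreasing when [nu >= 1/2].  Monotonicity of [q] follows,
    since [exp x * (1 - ln x)] is strictly decreasing on (0, 1].  That [rho]
    vanishes at infinity means [I_(-nu) / I_nu -> 1], which comes from log-convexity
    of Gamma applied term by term to the series; the same estimate controls the
    passage to integer orders. *)

(** Both bounds on [rho] are estimates of a logarithmic derivative. Since [K] is a constant multiple
    of [I rho], one has [- x K' / K = 1 / (I^2 rho) - w / I]; the upper bound thus reads
    [- x K' / K >= x I' / I] and the lower one [- x K' / K <= x + s]. The parameter [s] is free
    because two choices are used: [s = nu] yields the monotonicity of [exp x * I K] and is
    admissible when [nu >= 1/2], while [s = nu + 1/2] is admissible for every [nu >= 0] and yields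
    positivity of [rho] and lower bounds uniform near integer orders. The obstacle is the integer
    orders, where the quotient defining [K] is 0/0. The factor [kappa] between that quotient and
    [I rho] is periodic in the order and stays between 1/2 and 4 close to integers, so the quotients
    at nearby orders are bounded and bounded away from 0, and inequalities for [I K] pass to the
    integer order through [Lim_seq]. Orders in (-1, 0) are reduced to positive ones by the evenness
    of [K] in its order. *)

(** * Elementary inequalities *)

Lemma ln_le_minus_1 (t : R) : 0 < t -> ln t <= t - 1.
Proof.
  intros Ht. generalize (exp_ineq1_le (ln t)). rewrite exp_ln by easy. lra.
Qed.

Lemma exp_le (x y : R) : x <= y -> exp x <= exp y.
Proof.
  intros [H | ->]; [apply Rlt_le; now apply exp_increasing | apply Rle_refl].
Qed.

Lemma Rpower_pos (x a : R) : 0 < Rpower x a.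
Proof. apply exp_pos. Qed.

(** The tangent bound [ln t <= t - 1] is applied at [a / m] and [b / m], with [m] the weighted mean;
    the weighted sum of the two right-hand sides vanishes. *)
Lemma weighted_AM_GM (h a b : R) : 0 <= h <= 1 -> 0 < a -> 0 < b ->
  Rpower a h * Rpower b (1 - h) <= h * a + (1 - h) * b.
Proof.
  intros Hh Ha Hb.
  set (m := h * a + (1 - h) * b).
  assert (Hm : 0 < m) by (unfold m; destruct (Rlt_dec 0 h); nra).
  unfold Rpower. rewrite <- exp_plus. rewrite <- (exp_ln m) by easy.
  assert (H1 := ln_le_minus_1 (a / m) ltac:(now apply Rdiv_lt_0_compat)).
  assert (H2 := ln_le_minus_1 (b / m) ltac:(now apply Rdiv_lt_0_compat)).
  rewrite ln_div in H1 by easy. rewrite ln_div in H2 by easy.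
  assert (E : h * (a / m - 1) + (1 - h) * (b / m - 1) = 0)
    by (unfold m; field; fold m; lra).
  apply exp_le. nra.
Qed.

(** * The reciprocal Gamma function *)

Definition gauss_rGamma (z : R) (n : nat) : R :=
  prod_f_R0 (fun k => z + INR k) n / (INR (fact n) * Rpower (INR n) z).

Lemma INR_fact_pos (n : nat) : 0 < INR (fact n).
Proof. apply lt_0_INR, lt_O_fact. Qed.

Lemma prod_f_R0_S (f : nat -> R) (n : nat) :
  prod_f_R0 f (S n) = prod_f_R0 f n * f (S n).
Proof. reflexivity. Qed.

Lemma prod_shift_pos (z : R) (n : nat) : 0 < z ->
  0 < prod_f_R0 (fun k => z + INR k) n.
Proof.
  intros Hz. induction n as [|n IH].
  - simpl; lra.
  - rewrite prod_f_R0_S. apply Rmult_lt_0_compat; [easy|].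
    generalize (pos_INR (S n)); lra.
Qed.

Lemma prod_shift_nonneg (z : R) (n : nat) : 0 <= z ->
  0 <= prod_f_R0 (fun k => z + INR k) n.
Proof.
  intros Hz. induction n as [|n IH].
  - simpl; lra.
  - rewrite prod_f_R0_S. apply Rmult_le_pos; [easy|]. generalize (pos_INR (S n)); lra.
Qed.

Lemma gauss_rGamma_den_pos (z : R) (n : nat) :
  0 < INR (fact n) * Rpower (INR n) z.
Proof. apply Rmult_lt_0_compat; [apply INR_fact_pos | apply Rpower_pos]. Qed.

Lemma gauss_rGamma_nonneg (z : R) (n : nat) : 0 <= z -> 0 <= gauss_rGamma z n.
Proof.
  intros Hz. apply Rmult_le_pos; [now apply prod_shift_nonneg|].
  apply Rlt_le, Rinv_0_lt_compat, gauss_rGamma_den_pos.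
Qed.

(** The ratio of consecutive terms is at most 1 because [ln (m + 1) - ln m >= 1 / (m + 1)] and
    [exp t >= 1 + t]. Indices start at 1, since at 0 the factor [Rpower (INR 0) z] is only a default
    value. *)
Lemma gauss_rGamma_decr (z : R) (n : nat) : 0 <= z ->
  gauss_rGamma z (S (S n)) <= gauss_rGamma z (S n).
Proof.
  intros Hz. unfold gauss_rGamma. set (m := S n).
  assert (Hm : 0 < INR m) by (apply lt_0_INR; lia).
  rewrite prod_f_R0_S.
  replace (INR (fact (S m))) with (INR (S m) * INR (fact m))
    by (rewrite <- mult_INR; easy).
  rewrite !S_INR.
  assert (HP := prod_shift_nonneg z m Hz).
  assert (HF := INR_fact_pos m).
  assert (Hl := ln_le_minus_1 (INR m / (INR m + 1))
    ltac:(apply Rdiv_lt_0_compat; lra)).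
  rewrite ln_div in Hl by lra.
  assert (K : (z + (INR m + 1)) * Rpower (INR m) z
              <= (INR m + 1) * Rpower (INR m + 1) z).
  { set (d := ln (INR m + 1) - ln (INR m)).
    replace (Rpower (INR m + 1) z) with (Rpower (INR m) z * exp (z * d))
      by (unfold Rpower, d; rewrite <- exp_plus; f_equal; ring).
    assert (/ (INR m + 1) <= d).
    { unfold d. replace (/ (INR m + 1)) with (- (INR m / (INR m + 1) - 1))
        by (field; lra). lra. }
    assert (1 + z / (INR m + 1) <= exp (z * d)).
    { apply Rle_trans with (1 + z * d); [|apply exp_ineq1_le].
      unfold Rdiv; nra. }
    assert (z + (INR m + 1) <= (INR m + 1) * exp (z * d)).
    { replace (z + (INR m + 1)) with ((INR m + 1) * (1 + z / (INR m + 1)))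
        by (field; lra). nra. }
    generalize (Rpower_pos (INR m) z). nra. }
  generalize (Rpower_pos (INR m) z), (Rpower_pos (INR m + 1) z). intros H1 H2.
  replace (prod_f_R0 (fun k => z + INR k) m * (z + (INR m + 1)) /
    ((INR m + 1) * INR (fact m) * Rpower (INR m + 1) z)) with
   (prod_f_R0 (fun k => z + INR k) m / (INR (fact m) * Rpower (INR m) z) *
     ((z + (INR m + 1)) * Rpower (INR m) z / ((INR m + 1) * Rpower (INR m + 1) z)))
   by (field; repeat split; lra).
  rewrite <- (Rmult_1_r (_ / (INR (fact m) * Rpower (INR m) z))) at 2.
  apply Rmult_le_compat_l.
  - apply (gauss_rGamma_nonneg z m Hz).
  - apply Rle_div_l; nra.
Qed.

Lemma gauss_rGamma_succ (z : R) (n : nat) :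
  0 < INR n -> z + INR n + 1 <> 0 ->
  gauss_rGamma z n =
  z * (INR n / (z + INR n + 1) * gauss_rGamma (z + 1) n).
Proof.
  intros Hn Hz.
  assert (E : prod_f_R0 (fun k => z + INR k) n * (z + INR n + 1) =
              z * prod_f_R0 (fun k => z + 1 + INR k) n).
  { clear Hn Hz. induction n as [|n IH]; [simpl; ring|].
    rewrite !prod_f_R0_S, S_INR.
    replace (z * (prod_f_R0 (fun k => z + 1 + INR k) n * (z + 1 + (INR n + 1))))
      with (z * prod_f_R0 (fun k => z + 1 + INR k) n * (z + 1 + (INR n + 1)))
      by ring.
    rewrite <- IH. ring. }
  unfold gauss_rGamma. rewrite Rpower_plus, Rpower_1 by easy.
  replace (prod_f_R0 (fun k => z + INR k) n) with
    (z * prod_f_R0 (fun k => z + 1 + INR k) n / (z + INR n + 1))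
    by (rewrite <- E; field; easy).
  field. repeat split; try easy; try lra.
  - apply Rgt_not_eq, Rpower_pos.
  - apply Rgt_not_eq, INR_fact_pos.
Qed.

Lemma is_lim_seq_shift_ratio (a : R) :
  is_lim_seq (fun n => INR n / (a + INR n)) 1.
Proof.
  apply is_lim_seq_incr_1.
  apply is_lim_seq_ext_loc with (fun n => / (a * / INR (S n) + 1)).
  - destruct (nfloor_ex (Rabs a) (Rabs_pos a)) as [N [_ HN]].
    exists N. intros n Hn. apply le_INR in Hn.
    rewrite S_INR. generalize (Rle_abs a), (Rle_abs (- a)), (pos_INR n).
    rewrite Rabs_Ropp. intros. field. lra.
  - replace (Finite 1) with (Rbar_inv (Finite (a * 0 + 1)))
      by (simpl; f_equal; field).
    apply is_lim_seq_inv; [|simpl; injection; lra].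
    apply is_lim_seq_plus'; [|apply is_lim_seq_const].
    apply is_lim_seq_mult'; [apply is_lim_seq_const|].
    replace (Finite 0) with (Rbar_inv p_infty) by easy.
    apply is_lim_seq_inv; [|easy].
    apply -> is_lim_seq_incr_1. apply is_lim_seq_INR.
Qed.

Lemma is_lim_seq_gauss_rGamma_step (z l : R) :
  is_lim_seq (gauss_rGamma (z + 1)) l -> is_lim_seq (gauss_rGamma z) (z * l).
Proof.
  intros H.
  apply is_lim_seq_ext_loc with
    (fun n => z * (INR n / (z + 1 + INR n) * gauss_rGamma (z + 1) n)).
  - destruct (nfloor_ex (Rabs z) (Rabs_pos z)) as [N [_ HN]].
    exists (S N). intros n Hn. apply le_INR in Hn. rewrite S_INR in Hn.
    generalize (Rle_abs z), (Rle_abs (- z)), (pos_INR N). rewrite Rabs_Ropp.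
    intros. rewrite (gauss_rGamma_succ z) by lra.
    now replace (z + INR n + 1) with (z + 1 + INR n) by ring.
  - replace (z * l) with (z * (1 * l)) by ring.
    apply is_lim_seq_mult'; [apply is_lim_seq_const|].
    apply is_lim_seq_mult'; [apply is_lim_seq_shift_ratio | easy].
Qed.

(** For [z >= 0] the sequence is nonincreasing from index 1 on and nonnegative; a negative argument
    is brought there by finitely many unit shifts. *)
Lemma is_lim_seq_rGamma (z : R) : is_lim_seq (gauss_rGamma z) (rGamma z).
Proof.
  enough (H : ex_finite_lim_seq (gauss_rGamma z)).
  { destruct H as [l Hl]. unfold rGamma. fold (gauss_rGamma z).
    now rewrite (is_lim_seq_unique _ _ Hl). }
  assert (H : forall (N : nat) (w : R), 0 <= w + INR N ->
                ex_finite_lim_seq (gauss_rGamma w)).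
  { induction N as [|N IH]; intros w Hw.
    - simpl in Hw.
      destruct (ex_finite_lim_seq_decr (fun n => gauss_rGamma w (S n)) 0)
        as [l Hl].
      + intros n. apply gauss_rGamma_decr; lra.
      + intros n. apply gauss_rGamma_nonneg; lra.
      + exists l. now apply is_lim_seq_incr_1.
    - destruct (IH (w + 1)) as [l Hl]; [rewrite S_INR in Hw; lra|].
      exists (w * l). now apply is_lim_seq_gauss_rGamma_step. }
  destruct (nfloor_ex (Rabs z) (Rabs_pos z)) as [N [_ HN]].
  apply (H (S N)). rewrite S_INR.
  generalize (Rle_abs (- z)). rewrite Rabs_Ropp. lra.
Qed.

Lemma rGamma_rec (z : R) : rGamma z = z * rGamma (z + 1).
Proof.
  assert (H1 := is_lim_seq_unique _ _ (is_lim_seq_rGamma z)).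
  assert (H2 := is_lim_seq_unique _ _
    (is_lim_seq_gauss_rGamma_step z _ (is_lim_seq_rGamma (z + 1)))).
  rewrite H1 in H2. now injection H2.
Qed.

Lemma rGamma_1 : rGamma 1 = 1.
Proof.
  assert (E : is_lim_seq (gauss_rGamma 1) 1).
  { apply is_lim_seq_ext_loc with (fun n => / (INR n / (1 + INR n))).
    - exists 1%nat. intros n Hn. apply le_INR in Hn. simpl in Hn.
      unfold gauss_rGamma. rewrite Rpower_1 by lra.
      replace (prod_f_R0 (fun k => 1 + INR k) n) with (INR (fact n) * (1 + INR n)).
      + generalize (INR_fact_pos n). intros. field. lra.
      + clear Hn. induction n as [|n IH]; [simpl; ring|].
        rewrite prod_f_R0_S. rewrite <- IH.
        replace (INR (fact (S n))) with (INR (S n) * INR (fact n))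
          by (rewrite <- mult_INR; easy).
        rewrite S_INR. ring.
    - replace (Finite 1) with (Rbar_inv (Finite 1)) by (simpl; f_equal; field).
      apply is_lim_seq_inv; [apply is_lim_seq_shift_ratio|].
      simpl; injection; lra. }
  assert (H1 := is_lim_seq_unique _ _ (is_lim_seq_rGamma 1)).
  rewrite (is_lim_seq_unique _ _ E) in H1. now injection H1.
Qed.

(* Log-convexity of Gamma, obtained factor by factor from
   [(1 + 1/a)^s <= 1 + s/a]. *)
Lemma prod_shift_le (w s : R) (n : nat) : 0 < w -> 0 <= s <= 1 ->
  prod_f_R0 (fun k => w + INR k) n * Rpower ((w + INR n + 1) / w) s
  <= prod_f_R0 (fun k => w + s + INR k) n.
Proof.
  intros Hw Hs.
  assert (B : forall a, 0 < a -> a * Rpower ((a + 1) / a) s <= a + s).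
  { intros a Ha.
    assert (H : 0 < (a + 1) / a) by (apply Rdiv_lt_0_compat; lra).
    assert (K := weighted_AM_GM s ((a + 1) / a) 1 Hs H Rlt_0_1).
    replace (Rpower 1 (1 - s)) with 1 in K
      by (unfold Rpower; rewrite ln_1, Rmult_0_r, exp_0; easy).
    replace (a + s) with (a * (s * ((a + 1) / a) + (1 - s) * 1)) by (field; lra).
    nra. }
  induction n as [|n IH].
  - simpl. rewrite !Rplus_0_r. now apply B.
  - rewrite !prod_f_R0_S.
    assert (Hn := pos_INR n). rewrite S_INR.
    assert (P := prod_shift_pos w n Hw).
    assert (B' := B (w + (INR n + 1)) ltac:(lra)).
    replace ((w + (INR n + 1) + 1) / w) with
      ((w + INR n + 1) / w * ((w + (INR n + 1) + 1) / (w + (INR n + 1))))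
      by (field; lra).
    rewrite <- Rpower_mult_distr by (apply Rdiv_lt_0_compat; lra).
    replace (w + s + (INR n + 1)) with (w + (INR n + 1) + s) by ring.
    set (p := Rpower ((w + INR n + 1) / w) s) in *.
    set (p' := Rpower ((w + (INR n + 1) + 1) / (w + (INR n + 1))) s) in *.
    replace (prod_f_R0 (fun k => w + INR k) n * (w + (INR n + 1)) * (p * p'))
      with ((prod_f_R0 (fun k => w + INR k) n * p) * ((w + (INR n + 1)) * p'))
      by ring.
    apply Rmult_le_compat; try easy.
    + apply Rmult_le_pos; [lra | apply Rlt_le, Rpower_pos].
    + apply Rmult_le_pos; [lra | apply Rlt_le, Rpower_pos].
Qed.

(** In terms of Gamma this is Wendel's inequality [Gamma (w + s) <= w^s Gamma w]. It is the limit of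
    [prod_shift_le], once [n^s] is bounded by [(w + n + 1)^s]. *)
Lemma rGamma_log_convex (w s : R) : 0 < w -> 0 <= s <= 1 ->
  rGamma w <= Rpower w s * rGamma (w + s).
Proof.
  intros Hw Hs.
  apply (is_lim_seq_le_loc (gauss_rGamma w)
           (fun n => Rpower w s * gauss_rGamma (w + s) n)
           (Finite (rGamma w)) (Finite (Rpower w s * rGamma (w + s)))).
  2: apply is_lim_seq_rGamma.
  2: apply (is_lim_seq_mult' (fun _ => Rpower w s));
       [apply is_lim_seq_const | apply is_lim_seq_rGamma].
  exists 1%nat. intros n Hn. apply le_INR in Hn. simpl in Hn.
  unfold gauss_rGamma. rewrite Rpower_plus.
  assert (H := prod_shift_le w s n Hw Hs).
  assert (P := prod_shift_pos w n Hw).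
  assert (L : Rpower (INR n) s <= Rpower w s * Rpower ((w + INR n + 1) / w) s).
  { rewrite Rpower_mult_distr by (try apply Rdiv_lt_0_compat; lra).
    apply Rle_Rpower_l; [lra|]. split; [lra|].
    replace (w * ((w + INR n + 1) / w)) with (w + INR n + 1) by (field; lra). lra. }
  assert (H1 := INR_fact_pos n). assert (H2 := Rpower_pos (INR n) w).
  assert (H3 := Rpower_pos (INR n) s). assert (H4 := Rpower_pos w s).
  set (A := prod_f_R0 (fun k => w + INR k) n) in *.
  set (B := prod_f_R0 (fun k => w + s + INR k) n) in *.
  apply Rmult_le_reg_r with (INR (fact n) * Rpower (INR n) w * Rpower (INR n) s).
  { repeat apply Rmult_lt_0_compat; easy. }
  replace (A / (INR (fact n) * Rpower (INR n) w)
             * (INR (fact n) * Rpower (INR n) w * Rpower (INR n) s))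
    with (A * Rpower (INR n) s) by (field; lra).
  replace (Rpower w s * (B / (INR (fact n) * (Rpower (INR n) w * Rpower (INR n) s)))
             * (INR (fact n) * Rpower (INR n) w * Rpower (INR n) s))
    with (Rpower w s * B) by (field; lra).
  apply Rle_trans with (A * (Rpower w s * Rpower ((w + INR n + 1) / w) s)); [nra|].
  replace (A * (Rpower w s * Rpower ((w + INR n + 1) / w) s)) with
    (Rpower w s * (A * Rpower ((w + INR n + 1) / w) s)) by ring.
  nra.
Qed.

Lemma rGamma_ge_1 (s : R) : 0 <= s <= 1 -> 1 <= rGamma (1 + s).
Proof.
  intros Hs. assert (H := rGamma_log_convex 1 s Rlt_0_1 Hs).
  rewrite rGamma_1 in H. unfold Rpower in H.
  rewrite ln_1, Rmult_0_r, exp_0 in H. lra.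
Qed.

(** Positivity on [1, 2] comes from [rGamma_ge_1]; the recurrence carries it upwards by unit steps
    and, once, downwards to (0, 1). *)
Lemma rGamma_pos (z : R) : 0 < z -> 0 < rGamma z.
Proof.
  assert (H : forall (N : nat) (w : R), 1 <= w <= INR N + 2 -> 0 < rGamma w).
  { induction N as [|N IH]; intros w Hw.
    - simpl in Hw. generalize (rGamma_ge_1 (w - 1) ltac:(lra)).
      replace (1 + (w - 1)) with w by ring. lra.
    - rewrite S_INR in Hw. destruct (Rle_dec w (INR N + 2)); [apply IH; lra|].
      assert (P : 0 < rGamma (w - 1)).
      { apply IH. generalize (pos_INR N). lra. }
      rewrite rGamma_rec in P. replace (w - 1 + 1) with w in P by ring.
      generalize (pos_INR N). nra. }
  intros Hz. rewrite rGamma_rec. apply Rmult_lt_0_compat; [easy|].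
  destruct (nfloor_ex z (Rlt_le _ _ Hz)) as [N [_ HN]].
  apply (H N). lra.
Qed.

(** Once [w >= 1], the recurrence makes [rGamma (w + INR k)] nonincreasing in [k]; smaller [w] adds
    finitely many values. *)
Lemma rGamma_shift_bounded (w : R) :
  exists C, forall k : nat, Rabs (rGamma (w + INR k)) <= C.
Proof.
  assert (H : forall (N : nat) (w : R), 1 <= w + INR N ->
     exists C, forall k : nat, Rabs (rGamma (w + INR k)) <= C).
  { clear w. induction N as [|N IH]; intros w Hw.
    - simpl in Hw. exists (rGamma w). intros k.
      rewrite Rabs_pos_eq
        by (apply Rlt_le, rGamma_pos; generalize (pos_INR k); lra).
      induction k as [|k IHk]; [simpl; rewrite Rplus_0_r; lra|].
      apply Rle_trans with (2 := IHk). rewrite (rGamma_rec (w + INR k)), S_INR.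
      generalize (pos_INR k); intros Hk.
      assert (P := rGamma_pos (w + (INR k + 1)) ltac:(lra)).
      replace (w + INR k + 1) with (w + (INR k + 1)) by ring. nra.
    - destruct (IH (w + 1)) as [C HC]; [rewrite S_INR in Hw; lra|].
      exists (Rmax C (Rabs (rGamma w))). intros [|k].
      + simpl. rewrite Rplus_0_r. apply Rmax_r.
      + apply Rle_trans with (2 := Rmax_l _ _).
        replace (w + INR (S k)) with (w + 1 + INR k) by (rewrite S_INR; ring).
        apply HC. }
  destruct (nfloor_ex (Rabs w) (Rabs_pos w)) as [N [_ HN]].
  apply (H (S (S N))). rewrite !S_INR.
  generalize (Rle_abs (- w)). rewrite Rabs_Ropp. lra.
Qed.

(** * The modified Bessel functions of the first kind *)

(* [BesselI nu x = (x/2)^nu * besselA nu ((x/2)^2)], and [besselA nu] is entire. *)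
Definition besselA_coef (nu : R) (k : nat) : R :=
  rGamma (nu + INR k + 1) / INR (fact k).

Definition besselA (nu y : R) : R := PSeries (besselA_coef nu) y.

(** The Gamma factors are bounded, and [|r|^n / n!] is a single term of the series of [exp |r|],
    hence at most its sum. *)
Lemma CV_radius_besselA (nu : R) : CV_radius (besselA_coef nu) = p_infty.
Proof.
  destruct (CV_radius_bounded (besselA_coef nu)) as [H _].
  assert (K : forall r : R, Rbar_le r (CV_radius (besselA_coef nu))).
  { intros r. apply H.
    destruct (rGamma_shift_bounded (nu + 1)) as [C HC].
    exists (C * exp (Rabs r)). intros n. unfold besselA_coef.
    replace (nu + INR n + 1) with (nu + 1 + INR n) by ring.
    replace (rGamma (nu + 1 + INR n) / INR (fact n) * r ^ n)
      with (rGamma (nu + 1 + INR n) * (r ^ n / INR (fact n)))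
      by (generalize (INR_fact_pos n); intros; field; lra).
    rewrite Rabs_mult.
    apply Rmult_le_compat; try apply Rabs_pos; [apply HC|].
    unfold Rdiv. rewrite Rabs_mult, <- RPow_abs.
    rewrite (Rabs_pos_eq (/ _)) by apply Rlt_le, Rinv_0_lt_compat, INR_fact_pos.
    apply Rle_trans with (sum_f_R0 (fun k => / INR (fact k) * Rabs r ^ k) n).
    - destruct n as [|n]; simpl sum_f_R0; [simpl; lra|].
      rewrite (Rmult_comm (Rabs r ^ S n)).
      apply Rle_trans with (0 + / INR (fact (S n)) * Rabs r ^ S n); [lra|].
      apply Rplus_le_compat_r. apply cond_pos_sum. intros k.
      apply Rmult_le_pos; [apply Rlt_le, Rinv_0_lt_compat, INR_fact_pos|].
      apply pow_le, Rabs_pos.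
    - unfold exp. destruct (exist_exp (Rabs r)) as [l Hl]. simpl.
      apply sum_incr; [exact Hl|]. intros k.
      apply Rmult_le_pos; [apply Rlt_le, Rinv_0_lt_compat, INR_fact_pos|].
      apply pow_le, Rabs_pos. }
  destruct (CV_radius (besselA_coef nu)) as [r| |]; [|easy|].
  - generalize (K (r + 1)). simpl. lra.
  - now generalize (K 0).
Qed.

Lemma besselA_inside (nu y : R) :
  Rbar_lt (Rabs y) (CV_radius (besselA_coef nu)).
Proof. now rewrite CV_radius_besselA. Qed.

Lemma ex_pseries_besselA (nu y : R) : ex_pseries (besselA_coef nu) y.
Proof. apply CV_radius_inside, besselA_inside. Qed.

Lemma is_derive_besselA (nu y : R) :
  is_derive (besselA nu) y (besselA (nu + 1) y).
Proof.
  replace (besselA (nu + 1) y) with (PSeries (PS_derive (besselA_coef nu)) y).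
  - apply is_derive_PSeries, besselA_inside.
  - apply PSeries_ext. intros n. unfold PS_derive, besselA_coef.
    replace (INR (fact (S n))) with (INR (S n) * INR (fact n))
      by (rewrite <- mult_INR; easy).
    replace (nu + INR (S n) + 1) with (nu + 1 + INR n + 1)
      by (rewrite S_INR; ring).
    field. split; [apply not_0_INR, fact_neq_0 | now apply not_0_INR].
Qed.

(** Coefficientwise, [rGamma z = z * rGamma (z + 1)] with [z = (nu + 1) + n]: the part [nu + 1]
    gives the first series, and [n / n! = 1 / (n - 1)!] gives the shifted one. *)
Lemma besselA_rec (nu y : R) :
  besselA nu y = (nu + 1) * besselA (nu + 1) y + y * besselA (nu + 2) y.
Proof.
  unfold besselA.
  rewrite <- (PSeries_incr_1 (besselA_coef (nu + 2))), <- PSeries_scal.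
  rewrite <- PSeries_plus.
  - apply PSeries_ext. intros n.
    unfold PS_plus, PS_scal, PS_incr_1, besselA_coef.
    change plus with Rplus. change scal with Rmult. change zero with 0.
    rewrite (rGamma_rec (nu + INR n + 1)).
    replace (nu + 1 + INR n + 1) with (nu + INR n + 1 + 1) by ring.
    destruct n as [|n].
    + simpl. rewrite !Rplus_0_r. field.
    + replace (INR (fact (S n))) with (INR (S n) * INR (fact n))
        by (rewrite <- mult_INR; easy).
      replace (nu + 2 + INR n + 1) with (nu + INR (S n) + 1 + 1)
        by (rewrite S_INR; ring).
      replace (nu + INR (S n) + 1) with (nu + 1 + INR (S n)) by ring.
      field. split; [apply not_0_INR, fact_neq_0 | now apply not_0_INR].
  - apply ex_pseries_scal; [apply Rmult_comm | apply ex_pseries_besselA].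
  - apply ex_pseries_incr_1, ex_pseries_besselA.
Qed.

Lemma besselA_0 (nu : R) : besselA nu 0 = rGamma (nu + 1).
Proof.
  unfold besselA. rewrite PSeries_0. unfold besselA_coef. simpl.
  rewrite Rplus_0_r. field.
Qed.

Lemma besselI_term (nu x : R) (k : nat) : 0 < x ->
  Rpower (x / 2) (2 * INR k + nu) * rGamma (nu + INR k + 1) / INR (fact k) =
  Rpower (x / 2) nu * (besselA_coef nu k * ((x / 2) ^ 2) ^ k).
Proof.
  intros Hx. rewrite Rpower_plus.
  replace (2 * INR k) with (INR (2 * k)) by (rewrite mult_INR; simpl; ring).
  rewrite Rpower_pow by lra. rewrite pow_mult. unfold besselA_coef, Rdiv. ring.
Qed.

Lemma BesselI_besselA (nu x : R) : 0 < x ->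
  BesselI nu x = Rpower (x / 2) nu * besselA nu ((x / 2) ^ 2).
Proof.
  intros Hx. unfold BesselI, besselA, PSeries. rewrite <- Series_scal_l.
  apply Series_ext. intros k. now apply besselI_term.
Qed.

Lemma ex_series_BesselI (nu x : R) : 0 < x ->
  ex_series (fun k : nat =>
    Rpower (x / 2) (2 * INR k + nu) * rGamma (nu + INR k + 1) / INR (fact k)).
Proof.
  intros Hx.
  apply ex_series_ext with
    (fun k => Rpower (x / 2) nu * (besselA_coef nu k * ((x / 2) ^ 2) ^ k)).
  { intros k. symmetry. now apply besselI_term. }
  apply (ex_series_scal_l (V := R_NormedModule)).
  apply ex_pseries_R, ex_pseries_besselA.
Qed.

Lemma BesselI_pos (nu x : R) : -1 < nu -> 0 < x -> 0 < BesselI nu x.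
Proof.
  intros Hnu Hx.
  set (f := fun k : nat =>
    Rpower (x / 2) (2 * INR k + nu) * rGamma (nu + INR k + 1) / INR (fact k)).
  assert (Hf : forall k, 0 < f k).
  { intros k. unfold f. apply Rdiv_lt_0_compat; [|apply INR_fact_pos].
    apply Rmult_lt_0_compat; [apply Rpower_pos|].
    apply rGamma_pos. generalize (pos_INR k); lra. }
  assert (Ef := ex_series_BesselI nu x Hx). fold f in Ef.
  unfold BesselI. fold f. rewrite Series_incr_1 by easy.
  apply Rlt_le_trans with (f 0%nat + 0); [generalize (Hf 0%nat); lra|].
  apply Rplus_le_compat_l.
  replace 0 with (Series (fun _ : nat => 0 * 0))
    by (rewrite Series_scal_l; ring).
  apply Series_le.
  - intros n. generalize (Hf (S n)). lra.
  - now apply (ex_series_incr_1 f) in Ef.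
Qed.

Lemma BesselI_rec (nu x : R) : 0 < x ->
  BesselI nu x =
  2 * (nu + 1) / x * BesselI (nu + 1) x + BesselI (nu + 2) x.
Proof.
  intros Hx. rewrite !BesselI_besselA by easy.
  rewrite (besselA_rec nu), !(Rpower_plus nu), Rpower_1 by lra.
  assert (E : Rpower (x / 2) 2 = (x / 2) ^ 2) by (apply (Rpower_pow 2); lra).
  rewrite E. field. lra.
Qed.

Lemma is_derive_BesselI (nu x : R) : 0 < x ->
  is_derive (BesselI nu) x (nu / x * BesselI nu x + BesselI (nu + 1) x).
Proof.
  intros Hx.
  apply is_derive_ext_loc with
    (fun t => Rpower (t / 2) nu * besselA nu ((t / 2) ^ 2)).
  { exists (mkposreal x Hx). intros t Ht. symmetry. apply BesselI_besselA.
    unfold ball in Ht. simpl in Ht. unfold AbsRing_ball, abs, minus, plus, opp in Ht.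
    simpl in Ht. apply Rabs_def2 in Ht. lra. }
  rewrite !BesselI_besselA by easy. rewrite Rpower_plus, Rpower_1 by lra.
  assert (D1 : is_derive (fun t => Rpower (t / 2) nu) x
                 (nu / x * Rpower (x / 2) nu)).
  { unfold Rpower. auto_derive; [lra|]. unfold Rdiv. field. lra. }
  assert (D2 : is_derive (fun t => besselA nu ((t / 2) ^ 2)) x
                 (x / 2 * besselA (nu + 1) ((x / 2) ^ 2))).
  { apply (is_derive_comp (besselA nu) (fun t => (t / 2) ^ 2)).
    - apply is_derive_besselA.
    - auto_derive; [easy|]. field. }
  replace (nu / x * (Rpower (x / 2) nu * besselA nu ((x / 2) ^ 2)) +
           Rpower (x / 2) nu * (x / 2) * besselA (nu + 1) ((x / 2) ^ 2))
    with (plus (mult (nu / x * Rpower (x / 2) nu) (besselA nu ((x / 2) ^ 2)))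
            (mult (Rpower (x / 2) nu) (x / 2 * besselA (nu + 1) ((x / 2) ^ 2))))
    by (unfold plus, mult; simpl; ring).
  apply (is_derive_mult (fun t => Rpower (t / 2) nu)
           (fun t => besselA nu ((t / 2) ^ 2)) x _ _ D1 D2).
  apply Rmult_comm.
Qed.

Lemma is_derive_BesselI_succ (nu x : R) : 0 < x ->
  is_derive (BesselI (nu + 1)) x
    (BesselI nu x - (nu + 1) / x * BesselI (nu + 1) x).
Proof.
  intros Hx. rewrite (BesselI_rec nu x Hx).
  replace (nu + 2) with (nu + 1 + 1) by ring.
  replace (2 * (nu + 1) / x * BesselI (nu + 1) x + BesselI (nu + 1 + 1) x -
     (nu + 1) / x * BesselI (nu + 1) x) with
    ((nu + 1) / x * BesselI (nu + 1) x + BesselI (nu + 1 + 1) x)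
    by (field; lra).
  now apply is_derive_BesselI.
Qed.

(* Log-convexity of Gamma bounds each term of the left-hand series by weighted
   AM-GM; since both sides are linear in [BesselI], this single estimate yields
   the behaviour at infinity and the continuity in the order. *)
Lemma BesselI_interpolation (nu h x : R) : -1 < nu -> 0 <= h <= 1 -> 0 < x ->
  BesselI (nu + h) x <=
  (1 - h) * BesselI nu x + (h + 2 * (1 - h) * h / x) * BesselI (nu + 1) x.
Proof.
  intros Hnu Hh Hx. unfold BesselI. rewrite <- !Series_scal_l, <- Series_plus.
  2, 3: apply (ex_series_scal_l (V := R_NormedModule)); now apply ex_series_BesselI.
  apply Series_le.
  2: apply (ex_series_plus (V := R_NormedModule));
     apply (ex_series_scal_l (V := R_NormedModule)); now apply ex_series_BesselI.
  intros k. set (z := nu + INR k + 1).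
  assert (Hz : 0 < z) by (unfold z; generalize (pos_INR k); lra).
  replace (nu + h + INR k + 1) with (z + h) by (unfold z; ring).
  replace (nu + 1 + INR k + 1) with (z + 1) by (unfold z; ring).
  assert (HF := INR_fact_pos k).
  split.
  { apply Rlt_le, Rdiv_lt_0_compat; [|easy].
    apply Rmult_lt_0_compat; [apply Rpower_pos | apply rGamma_pos; lra]. }
  replace (2 * INR k + (nu + h)) with (2 * INR k + nu + h) by ring.
  replace (2 * INR k + (nu + 1)) with (2 * INR k + nu + 1) by ring.
  rewrite !(Rpower_plus (2 * INR k + nu)), Rpower_1 by lra.
  set (p := Rpower (x / 2) (2 * INR k + nu)).
  assert (Hp : 0 < p) by apply Rpower_pos.
  rewrite (rGamma_rec z).
  assert (G := rGamma_log_convex (z + h) (1 - h) ltac:(lra) ltac:(lra)).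
  replace (z + h + (1 - h)) with (z + 1) in G by ring.
  assert (M := weighted_AM_GM h (x / 2) (z + h) Hh ltac:(lra) ltac:(lra)).
  assert (P := rGamma_pos (z + 1) ltac:(lra)).
  assert (Q := Rpower_pos (x / 2) h).
  set (g := rGamma (z + 1)) in *. set (a := Rpower (x / 2) h) in *.
  set (b := Rpower (z + h) (1 - h)) in *.
  (* After factoring out [p * g / k!], the majorant splits as [(1 - h) * z], the term of order [nu],
     plus [h * (x / 2)], a term of order [nu + 1], plus the remainder [(1 - h) * h]. Writing the
     remainder as [2 * (1 - h) * h / x * (x / 2)] charges it to order [nu + 1]. *)
  apply Rle_trans with (p / INR (fact k) * ((h * (x / 2) + (1 - h) * (z + h)) * g)).
  - replace (p * a * rGamma (z + h) / INR (fact k)) with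
      (p / INR (fact k) * (a * rGamma (z + h))) by (field; lra).
    apply Rmult_le_compat_l; [apply Rlt_le, Rdiv_lt_0_compat; lra|].
    apply Rle_trans with (a * (b * g)); nra.
  - right. field. lra.
Qed.

(** * Energy inequality and comparison of nearby orders *)

Lemma nonincreasing_of_derive (f df : R -> R) :
  (forall x, 0 < x -> is_derive f x (df x)) ->
  (forall x, 0 < x -> df x <= 0) ->
  forall x y, 0 < x -> x <= y -> f y <= f x.
Proof.
  intros Hd Hn x y Hx Hxy.
  destruct (MVT_gen f x y df) as [c [Hc E]].
  - intros t. rewrite Rmin_left, Rmax_right by easy. intros Ht. apply Hd. lra.
  - intros t. rewrite Rmin_left, Rmax_right by easy. intros Ht.
    apply continuity_pt_filterlim, (ex_derive_continuous f).
    exists (df t). apply Hd. lra.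
  - rewrite Rmin_left, Rmax_right in Hc by easy.
    generalize (Hn c ltac:(lra)). nra.
Qed.

Lemma BesselI_nondecreasing (nu x y : R) : 0 <= nu -> 0 < x -> x <= y ->
  BesselI nu x <= BesselI nu y.
Proof.
  intros Hnu Hx Hxy. apply Ropp_le_cancel.
  apply (nonincreasing_of_derive (fun t => - BesselI nu t)
    (fun t => - (nu / t * BesselI nu t + BesselI (nu + 1) t))); try easy.
  - intros t Ht. apply (is_derive_opp (BesselI nu)). now apply is_derive_BesselI.
  - intros t Ht. assert (P := BesselI_pos nu t ltac:(lra) Ht).
    assert (P1 := BesselI_pos (nu + 1) t ltac:(lra) Ht).
    assert (0 <= nu / t)
      by (apply Rmult_le_pos; [easy | now apply Rlt_le, Rinv_0_lt_compat]).
    nra.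
Qed.

(* Equivalent to [(x I')^2 <= (x^2 + nu^2) I^2] with [x I' = nu I + x J]; the
   difference of the two sides has derivative [-2 x I^2] and vanishes at 0. *)
Lemma BesselI_energy (nu x : R) : 0 <= nu -> 0 < x ->
  2 * nu * BesselI nu x * BesselI (nu + 1) x + x * BesselI (nu + 1) x ^ 2
  <= x * BesselI nu x ^ 2.
Proof.
  intros Hnu Hx.
  set (E := fun t => 2 * nu * t * BesselI nu t * BesselI (nu + 1) t
                     + t ^ 2 * BesselI (nu + 1) t ^ 2 - t ^ 2 * BesselI nu t ^ 2).
  assert (HE : forall s t, 0 < s -> s <= t -> E t <= E s).
  { apply nonincreasing_of_derive with (fun t => - (2 * t * BesselI nu t ^ 2)).
    - intros t Ht. unfold E.
      assert (D := is_derive_BesselI nu t Ht).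
      assert (D1 := is_derive_BesselI_succ nu t Ht).
      auto_derive.
      + repeat split; try (eexists; eassumption).
      + replace (Derive (fun x => BesselI nu x) t)
          with (nu / t * BesselI nu t + BesselI (nu + 1) t)
          by (symmetry; now apply is_derive_unique).
        replace (Derive (fun x => BesselI (nu + 1) x) t)
          with (BesselI nu t - (nu + 1) / t * BesselI (nu + 1) t)
          by (symmetry; now apply is_derive_unique).
        field. lra.
    - intros t Ht. generalize (pow2_ge_0 (BesselI nu t)). nra. }
  assert (P := BesselI_pos nu x ltac:(lra) Hx).
  assert (P1 := BesselI_pos (nu + 1) x ltac:(lra) Hx).
  set (M := 2 * nu * BesselI nu x * BesselI (nu + 1) x
            + x * BesselI (nu + 1) x ^ 2).
  assert (HM : 0 <= M).
  { unfold M. assert (0 <= nu * (BesselI nu x * BesselI (nu + 1) x))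
      by (apply Rmult_le_pos; [easy | nra]).
    assert (0 <= x * BesselI (nu + 1) x ^ 2)
      by (apply Rmult_le_pos; [lra | apply pow2_ge_0]). lra. }
  (* This replaces the value at 0: [E] is nonincreasing, and [E e] is at most [e * M] because [I]
     and [J] are nondecreasing. *)
  assert (B : forall e, 0 < e -> e <= x -> E x <= e * M).
  { intros e He Hex. apply Rle_trans with (1 := HE e x He Hex).
    assert (Q := BesselI_pos nu e ltac:(lra) He).
    assert (Q1 := BesselI_pos (nu + 1) e ltac:(lra) He).
    assert (L := BesselI_nondecreasing nu e x Hnu He Hex).
    assert (L1 := BesselI_nondecreasing (nu + 1) e x ltac:(lra) He Hex).
    unfold E, M.
    assert (BesselI nu e * BesselI (nu + 1) e <= BesselI nu x * BesselI (nu + 1) x)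
      by nra.
    assert (BesselI (nu + 1) e ^ 2 <= BesselI (nu + 1) x ^ 2) by nra.
    assert (nu * (BesselI nu e * BesselI (nu + 1) e)
            <= nu * (BesselI nu x * BesselI (nu + 1) x)) by nra.
    assert (e * BesselI (nu + 1) e ^ 2 <= x * BesselI (nu + 1) x ^ 2)
      by (apply Rmult_le_compat; nra).
    assert (0 <= e ^ 2 * BesselI nu e ^ 2) by nra.
    nra. }
  assert (EX : E x <= 0).
  { apply Rnot_lt_le. intros Hpos.
    (* Chosen so that [e * M < E x], contradicting [B]. *)
    set (e := Rmin x (E x / (2 * (M + 1)))).
    assert (He : 0 < e).
    { apply Rmin_glb_lt; [easy|]. apply Rdiv_lt_0_compat; lra. }
    assert (He' := Rmin_r x (E x / (2 * (M + 1)))). fold e in He'.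
    apply Rle_div_r in He'; [|lra].
    generalize (B e He (Rmin_l _ _)). nra. }
  unfold E in EX. apply Rmult_le_reg_l with x; [easy|]. unfold M. lra.
Qed.

Lemma BesselI_succ_le (nu x : R) : 0 <= nu -> 0 < x ->
  BesselI (nu + 1) x <= BesselI nu x.
Proof.
  intros Hnu Hx. assert (E := BesselI_energy nu x Hnu Hx).
  assert (P := BesselI_pos nu x ltac:(lra) Hx).
  assert (P1 := BesselI_pos (nu + 1) x ltac:(lra) Hx).
  assert (0 <= nu * (BesselI nu x * BesselI (nu + 1) x))
    by (apply Rmult_le_pos; [easy | nra]).
  assert (BesselI (nu + 1) x ^ 2 <= BesselI nu x ^ 2) by nra.
  nra.
Qed.

Lemma BesselI_le_succ (nu x : R) : 0 <= nu -> 0 < x ->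
  BesselI nu x <= (1 + 2 * (nu + 1) / x) * BesselI (nu + 1) x.
Proof.
  intros Hnu Hx. rewrite (BesselI_rec nu x Hx).
  assert (L := BesselI_succ_le (nu + 1) x ltac:(lra) Hx).
  replace (nu + 2) with (nu + 1 + 1) by ring. lra.
Qed.

Lemma BesselI_shift_le (nu h x : R) : 0 <= nu -> 0 <= h <= 1 -> 0 < x ->
  BesselI (nu + h) x <= (1 + 2 * h / x) * BesselI nu x.
Proof.
  intros Hnu Hh Hx.
  apply Rle_trans with (1 := BesselI_interpolation nu h x ltac:(lra) Hh Hx).
  assert (L := BesselI_succ_le nu x Hnu Hx).
  assert (P1 := BesselI_pos (nu + 1) x ltac:(lra) Hx).
  assert (Hi : 0 < / x) by now apply Rinv_0_lt_compat.
  assert (0 <= (1 - h) * h <= h) by nra.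
  assert (0 <= 2 * (1 - h) * h / x <= 2 * h / x) by (unfold Rdiv; split; nra).
  assert (2 * (1 - h) * h / x * BesselI (nu + 1) x <= 2 * h / x * BesselI nu x)
    by nra.
  nra.
Qed.

(** Interpolation from the base order [nu - 1 + h], which exceeds -1, with step [1 - h] lands on
    [nu]; the recurrence then removes the base order. As in [BesselI_shift_le], the error is
    proportional to [h], which makes the pair usable as [h] tends to 0. *)
Lemma BesselI_le_shift (nu h x : R) : 0 <= nu -> 0 < h <= 1 -> 0 < x ->
  BesselI nu x <= (1 + 2 * h * (nu + 1) / x) * BesselI (nu + h) x.
Proof.
  intros Hnu Hh Hx.
  assert (I := BesselI_interpolation (nu - 1 + h) (1 - h) x
                 ltac:(lra) ltac:(lra) Hx).
  replace (nu - 1 + h + (1 - h)) with nu in I by ring.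
  rewrite (BesselI_rec (nu - 1 + h)) in I by easy.
  replace (nu - 1 + h + 1) with (nu + h) in I by ring.
  replace (nu - 1 + h + 2) with (nu + h + 1) in I by ring.
  assert (L := BesselI_succ_le (nu + h) x ltac:(lra) Hx).
  apply Rle_trans with (1 := I).
  apply Rle_trans with ((1 - (1 - h)) *
    (2 * (nu + h) / x * BesselI (nu + h) x + BesselI (nu + h) x) +
    (1 - h + 2 * (1 - (1 - h)) * (1 - h) / x) * BesselI (nu + h) x).
  - apply Rplus_le_compat_r. nra.
  - right. field. lra.
Qed.

(** * Equivalence at infinity of all orders *)

Definition equiv_infty (f g : R -> R) : Prop :=
  is_lim (fun x => f x / g x) p_infty 1.

Lemma equiv_infty_neq_0 (f g : R -> R) : equiv_infty f g ->
  Rbar_locally' p_infty (fun x => f x <> 0).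
Proof.
  intros H. apply is_lim_spec in H. destruct (H (mkposreal 1 Rlt_0_1)) as [M HM].
  exists M. intros x Hx E. specialize (HM x Hx). simpl in HM.
  rewrite E in HM. unfold Rdiv in HM. rewrite Rmult_0_l in HM.
  replace (0 - 1) with (- (1)) in HM by ring. rewrite Rabs_Ropp, Rabs_R1 in HM. lra.
Qed.

Lemma equiv_infty_sym (f g : R -> R) : equiv_infty f g -> equiv_infty g f.
Proof.
  intros H. unfold equiv_infty.
  apply is_lim_ext with (fun x => / (f x / g x)).
  { intros x. unfold Rdiv. rewrite Rinv_mult, Rinv_inv. ring. }
  replace (Finite 1) with (Rbar_inv (Finite 1)) by (simpl; f_equal; field).
  apply is_lim_inv; [easy|]. simpl. injection. lra.
Qed.

Lemma equiv_infty_trans (f g h : R -> R) :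
  equiv_infty f g -> equiv_infty g h -> equiv_infty f h.
Proof.
  intros H1 H2. unfold equiv_infty.
  apply is_lim_ext_loc with (fun x => (f x / g x) * (g x / h x)).
  - destruct (equiv_infty_neq_0 _ _ H2) as [M HM]. exists M. intros x Hx.
    unfold Rdiv. rewrite <- (Rmult_1_r (f x * / h x)).
    rewrite <- (Rinv_r (g x)) by now apply HM. ring.
  - replace (Finite 1) with (Finite (1 * 1)) by (f_equal; ring).
    apply (is_lim_mult _ _ p_infty 1 1); easy.
Qed.

Lemma is_lim_const_div_infty (c : R) : is_lim (fun x => c / x) p_infty 0.
Proof.
  replace (Finite 0) with (Rbar_mult (Finite c) (Rbar_inv p_infty))
    by (simpl; f_equal; ring).
  apply is_lim_scal_l. apply is_lim_inv; [apply is_lim_id | easy].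
Qed.

Lemma is_lim_one_plus_div_infty (c : R) :
  is_lim (fun x => 1 + c / x) p_infty 1.
Proof.
  replace (Finite 1) with (Finite (1 + 0)) by (f_equal; ring).
  apply is_lim_plus'; [apply is_lim_const | apply is_lim_const_div_infty].
Qed.

(** Steps of length [h] and [1 - h] lead from [nu] to [nu + 1], and [BesselI_le_succ] returns to
    [nu]; each costs a factor [1 + O(1/x)]. *)
Lemma BesselI_equiv_shift (nu h : R) : 0 <= nu -> 0 <= h <= 1 ->
  equiv_infty (BesselI (nu + h)) (BesselI nu).
Proof.
  intros Hnu Hh.
  apply is_lim_le_le_loc with
    (fun x => / ((1 + 2 / x) * (1 + 2 * (nu + 1) / x))) (fun x => 1 + 2 / x).
  - exists 0. intros x Hx.
    assert (P := BesselI_pos nu x ltac:(lra) Hx).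
    assert (Ph := BesselI_pos (nu + h) x ltac:(lra) Hx).
    assert (U := BesselI_shift_le nu h x Hnu Hh Hx).
    assert (L := BesselI_shift_le (nu + h) (1 - h) x ltac:(lra) ltac:(lra) Hx).
    replace (nu + h + (1 - h)) with (nu + 1) in L by ring.
    assert (L' := BesselI_le_succ nu x Hnu Hx).
    assert (2 * h / x <= 2 / x /\ 2 * (1 - h) / x <= 2 / x).
    { assert (0 < / x) by now apply Rinv_0_lt_compat. unfold Rdiv. split; nra. }
    assert (0 < 2 / x) by (apply Rdiv_lt_0_compat; lra).
    assert (0 < 2 * (nu + 1) / x) by (apply Rdiv_lt_0_compat; lra).
    split.
    + apply Rle_div_r; [easy|].
      apply Rmult_le_reg_l with ((1 + 2 / x) * (1 + 2 * (nu + 1) / x)); [nra|].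
      rewrite <- Rmult_assoc, Rinv_r, Rmult_1_l by nra.
      apply Rle_trans with (1 := L').
      rewrite (Rmult_comm (1 + 2 / x)), Rmult_assoc.
      apply Rmult_le_compat_l; nra.
    + apply Rle_div_l; [easy | nra].
  - replace (Finite 1) with (Rbar_inv (Finite (1 * 1)))
      by (simpl; f_equal; field).
    apply is_lim_inv; [|simpl; injection; lra].
    apply (is_lim_mult _ _ p_infty 1 1); try easy;
      apply is_lim_one_plus_div_infty.
  - apply is_lim_one_plus_div_infty.
Qed.

(** Negative orders are reached by descending: the recurrence gives [I_mu / I_(mu+1) = I_(mu+2) /
    I_(mu+1) + 2 (mu + 1) / x]. *)
Lemma BesselI_equiv_succ (nu : R) :
  equiv_infty (BesselI (nu + 1)) (BesselI nu).
Proof.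
  assert (H : forall (N : nat) (mu : R), 0 <= mu + INR N ->
    equiv_infty (BesselI (mu + 1)) (BesselI mu)).
  { induction N as [|N IH]; intros mu Hmu.
    - simpl in Hmu. apply BesselI_equiv_shift; lra.
    - assert (K := IH (mu + 1) ltac:(rewrite S_INR in Hmu; lra)).
      apply equiv_infty_sym. unfold equiv_infty.
      apply is_lim_ext_loc with
        (fun x => BesselI (mu + 1 + 1) x / BesselI (mu + 1) x + 2 * (mu + 1) / x).
      + destruct (equiv_infty_neq_0 _ _ (equiv_infty_sym _ _ K)) as [M HM].
        exists (Rmax 0 M). intros x Hx.
        assert (0 < x) by (apply Rle_lt_trans with (2 := Hx), Rmax_l).
        assert (M < x) by (apply Rle_lt_trans with (2 := Hx), Rmax_r).
        rewrite (BesselI_rec mu) by easy.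
        replace (mu + 2) with (mu + 1 + 1) by ring.
        field. split; [lra | now apply HM].
      + replace (Finite 1) with (Finite (1 + 0)) by (f_equal; ring).
        apply is_lim_plus'; [exact K | apply is_lim_const_div_infty]. }
  destruct (nfloor_ex (Rabs nu) (Rabs_pos nu)) as [N [_ HN]].
  apply (H (S N)). rewrite S_INR.
  generalize (Rle_abs (- nu)). rewrite Rabs_Ropp. lra.
Qed.

Lemma BesselI_equiv_add_nat (nu : R) (N : nat) :
  equiv_infty (BesselI (nu + INR N + 1)) (BesselI nu).
Proof.
  induction N as [|N IH].
  - simpl. rewrite Rplus_0_r. apply BesselI_equiv_succ.
  - apply equiv_infty_trans with (2 := IH). rewrite S_INR.
    replace (nu + (INR N + 1) + 1) with (nu + INR N + 1 + 1) by ring.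
    apply BesselI_equiv_succ.
Qed.

(** With [N] the integer part of [2 * nu], climbing [N + 1] unit steps from [- nu] ends at distance
    at most 1 above [nu]. *)
Lemma BesselI_equiv_opp (nu : R) : 0 <= nu ->
  equiv_infty (BesselI (- nu)) (BesselI nu).
Proof.
  intros Hnu. destruct (nfloor_ex (2 * nu) ltac:(lra)) as [N [H1 H2]].
  apply equiv_infty_trans with (BesselI (- nu + INR N + 1)).
  { apply equiv_infty_sym, BesselI_equiv_add_nat. }
  replace (- nu + INR N + 1) with (nu + (INR N + 1 - 2 * nu)) by ring.
  apply BesselI_equiv_shift; lra.
Qed.

(** * The ratio of two solutions *)

(* Stated for the entire parts, so that the constant is read off at [y = 0]. *)
Lemma besselA_wronskian (nu y : R) :
  besselA nu y * besselA (- nu - 1) y - y * besselA (nu + 1) y * besselA (- nu) y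
  = rGamma (nu + 1) * rGamma (- nu).
Proof.
  set (f := fun t => besselA nu t * besselA (- nu - 1) t
                     - t * besselA (nu + 1) t * besselA (- nu) t).
  assert (D : forall t, is_derive f t 0).
  { intros t. unfold f.
    assert (D1 := is_derive_besselA nu t).
    assert (D2 := is_derive_besselA (nu + 1) t).
    assert (D3 := is_derive_besselA (- nu) t).
    assert (D4 := is_derive_besselA (- nu - 1) t).
    replace (- nu - 1 + 1) with (- nu) in D4 by ring.
    replace (nu + 1 + 1) with (nu + 2) in D2 by ring.
    auto_derive.
    - repeat split; try (eexists; eassumption).
    - replace (Derive (fun x => besselA nu x) t) with (besselA (nu + 1) t)
        by (symmetry; now apply is_derive_unique).
      replace (Derive (fun x => besselA (nu + 1) x) t) with (besselA (nu + 2) t)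
        by (symmetry; now apply is_derive_unique).
      replace (Derive (fun x => besselA (- nu) x) t) with (besselA (- nu + 1) t)
        by (symmetry; now apply is_derive_unique).
      replace (Derive (fun x => besselA (- nu - 1) x) t) with (besselA (- nu) t)
        by (symmetry; now apply is_derive_unique).
      rewrite (besselA_rec nu), (besselA_rec (- nu - 1)).
      replace (- nu - 1 + 1) with (- nu) by ring.
      replace (- nu - 1 + 2) with (- nu + 1) by ring. ring. }
  destruct (MVT_gen f 0 y (fun _ => 0)) as [c [_ E]].
  - intros t _. apply D.
  - intros t _. apply continuity_pt_filterlim, (ex_derive_continuous f).
    exists 0. apply D.
  - unfold f in E. rewrite !besselA_0 in E.
    replace (- nu - 1 + 1) with (- nu) in E by ring. lra.
Qed.

Lemma BesselI_wronskian (nu x : R) : 0 < x ->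
  BesselI nu x * BesselI (- nu - 1) x - BesselI (nu + 1) x * BesselI (- nu) x
  = 2 * rGamma (nu + 1) * rGamma (- nu) / x.
Proof.
  intros Hx. rewrite !BesselI_besselA by easy.
  assert (E1 : Rpower (x / 2) nu * Rpower (x / 2) (- nu - 1) = 2 / x).
  { rewrite <- Rpower_plus. replace (nu + (- nu - 1)) with (- (1)) by ring.
    rewrite Rpower_Ropp, Rpower_1 by lra. field. lra. }
  assert (E2 : Rpower (x / 2) (nu + 1) * Rpower (x / 2) (- nu) = x / 2).
  { rewrite <- Rpower_plus. replace (nu + 1 + - nu) with 1 by ring.
    apply Rpower_1. lra. }
  set (y := (x / 2) ^ 2).
  replace (Rpower (x / 2) nu * besselA nu y *
           (Rpower (x / 2) (- nu - 1) * besselA (- nu - 1) y) -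
           Rpower (x / 2) (nu + 1) * besselA (nu + 1) y *
           (Rpower (x / 2) (- nu) * besselA (- nu) y)) with
    (Rpower (x / 2) nu * Rpower (x / 2) (- nu - 1)
       * (besselA nu y * besselA (- nu - 1) y)
     - Rpower (x / 2) (nu + 1) * Rpower (x / 2) (- nu)
       * (besselA (nu + 1) y * besselA (- nu) y)) by ring.
  rewrite E1, E2.
  replace (2 * rGamma (nu + 1) * rGamma (- nu) / x)
    with (2 / x * (rGamma (nu + 1) * rGamma (- nu))) by (field; lra).
  rewrite <- (besselA_wronskian nu y). unfold y. field. lra.
Qed.

(* The constant is [2 sin(nu pi) / pi] by the reflection formula, of which only
   the sign and some crude bounds are needed. *)
Definition wronskian_const (nu : R) : R := - (2 * rGamma (nu + 1) * rGamma (- nu)).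

(* The decaying solution divided by [BesselI nu], normalised so that its
   derivative is [- 1 / (x I^2)]. *)
Definition besselRho (nu x : R) : R :=
  (BesselI (- nu) x / BesselI nu x - 1) / wronskian_const nu.

(** The numerator of the quotient rule becomes the left-hand side of [BesselI_wronskian] after
    applying the recurrence at order [- nu - 1]. *)
Lemma is_derive_besselRho (nu x : R) : -1 < nu -> 0 < x ->
  wronskian_const nu <> 0 ->
  is_derive (besselRho nu) x (- / (x * BesselI nu x ^ 2)).
Proof.
  intros Hnu Hx Hc. unfold besselRho.
  assert (P := BesselI_pos nu x Hnu Hx).
  assert (D := is_derive_BesselI nu x Hx).
  assert (D' := is_derive_BesselI (- nu) x Hx).
  assert (W := BesselI_wronskian nu x Hx).
  assert (Rc := BesselI_rec (- nu - 1) x Hx).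
  replace (- nu - 1 + 1) with (- nu) in Rc by ring.
  replace (- nu - 1 + 2) with (- nu + 1) in Rc by ring.
  auto_derive.
  - repeat split; try (eexists; eassumption); lra.
  - replace (Derive (fun x => BesselI nu x) x)
      with (nu / x * BesselI nu x + BesselI (nu + 1) x)
      by (symmetry; now apply is_derive_unique).
    replace (Derive (fun x => BesselI (- nu) x) x)
      with (- nu / x * BesselI (- nu) x + BesselI (- nu + 1) x)
      by (symmetry; now apply is_derive_unique).
    assert (K : BesselI (nu + 1) x * BesselI (- nu) x
      = BesselI nu x * BesselI (- nu - 1) x + wronskian_const nu / x)
      by (unfold wronskian_const; lra).
    rewrite Rc in K.
    apply Rmult_eq_reg_l with (wronskian_const nu * x * BesselI nu x ^ 2).
    2: { apply Rmult_integral_contrapositive_currified; [|apply pow_nonzero; lra].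
         apply Rmult_integral_contrapositive_currified; [easy | lra]. }
    transitivity (x * ((- nu / x * BesselI (- nu) x + BesselI (- nu + 1) x)
        * BesselI nu x - (nu / x * BesselI nu x) * BesselI (- nu) x
      - BesselI (nu + 1) x * BesselI (- nu) x)).
    + field. repeat split; lra || easy.
    + rewrite K. field. repeat split; lra || easy.
Qed.

Lemma is_lim_besselRho (nu : R) : 0 <= nu -> is_lim (besselRho nu) p_infty 0.
Proof.
  intros Hnu. unfold besselRho, Rdiv at 1.
  replace (Finite 0) with (Rbar_mult (Finite (1 - 1)) (/ wronskian_const nu))
    by (simpl; f_equal; ring).
  apply is_lim_scal_r.
  apply is_lim_minus'; [now apply BesselI_equiv_opp | apply is_lim_const].
Qed.

(** * Two-sided bounds on the ratio *)

Lemma nonincreasing_lim_nonneg (f g : R -> R) :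
  (forall x y, 0 < x -> x <= y -> f y <= f x) ->
  is_lim g p_infty 0 ->
  (forall x, 1 < x -> g x <= f x) ->
  forall x, 0 < x -> 0 <= f x.
Proof.
  intros Hf Hg Hle x Hx.
  apply (is_lim_le_loc g (fun _ => f x) p_infty 0 (f x)).
  - exists (Rmax 1 x). intros t Ht.
    assert (1 < t) by (apply Rle_lt_trans with (2 := Ht), Rmax_l).
    assert (x < t) by (apply Rle_lt_trans with (2 := Ht), Rmax_r).
    apply Rle_trans with (f t); [now apply Hle | apply Hf; lra].
  - easy.
  - apply is_lim_const.
Qed.

(** The Bessel equation reads [w' = (t^2 + nu^2) I / t]. Hence the derivative of [/ (2 I w) - rho]
    has the sign of [w^2 - (t^2 + nu^2) I^2], which [BesselI_energy] controls. *)
Lemma besselRho_upper (nu x : R) : 0 <= nu -> 0 < x ->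
  wronskian_const nu <> 0 ->
  besselRho nu x
  <= / (2 * BesselI nu x * (nu * BesselI nu x + x * BesselI (nu + 1) x)).
Proof.
  intros Hnu Hx Hc. apply Rminus_le_0.
  set (N := fun t => 2 * BesselI nu t * (nu * BesselI nu t + t * BesselI (nu + 1) t)).
  assert (HN : forall t, 0 < t -> 0 < N t).
  { intros t Ht. unfold N.
    assert (P := BesselI_pos nu t ltac:(lra) Ht).
    assert (P1 := BesselI_pos (nu + 1) t ltac:(lra) Ht).
    apply Rmult_lt_0_compat; [lra|].
    assert (0 < t * BesselI (nu + 1) t) by now apply Rmult_lt_0_compat. nra. }
  apply (nonincreasing_lim_nonneg (fun t => / N t - besselRho nu t)
           (fun t => - besselRho nu t)); try easy.
  - apply nonincreasing_of_derive with
      (fun t => - (2 * ((nu * BesselI nu t + t * BesselI (nu + 1) t) ^ 2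
                        + (t ^ 2 + nu ^ 2) * BesselI nu t ^ 2) / t) / N t ^ 2
                + / (t * BesselI nu t ^ 2)).
    + intros t Ht.
      assert (D := is_derive_BesselI nu t Ht).
      assert (D1 := is_derive_BesselI_succ nu t Ht).
      assert (DR := is_derive_besselRho nu t ltac:(lra) Ht Hc).
      assert (PN := HN t Ht).
      assert (P := BesselI_pos nu t ltac:(lra) Ht).
      unfold N in *. auto_derive.
      * repeat split; try (eexists; eassumption). lra.
      * replace (Derive (fun x => BesselI nu x) t)
          with (nu / t * BesselI nu t + BesselI (nu + 1) t)
          by (symmetry; now apply is_derive_unique).
        replace (Derive (fun x => BesselI (nu + 1) x) t)
          with (BesselI nu t - (nu + 1) / t * BesselI (nu + 1) t)
          by (symmetry; now apply is_derive_unique).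
        replace (Derive (fun x => besselRho nu x) t)
          with (- / (t * BesselI nu t ^ 2))
          by (symmetry; now apply is_derive_unique).
        field. repeat split; try lra. intros Z. rewrite Z in PN. lra.
    + intros t Ht.
      assert (E := BesselI_energy nu t Hnu Ht).
      assert (P := BesselI_pos nu t ltac:(lra) Ht).
      assert (PN := HN t Ht).
      set (w := nu * BesselI nu t + t * BesselI (nu + 1) t) in *.
      assert (E' : w ^ 2 <= (t ^ 2 + nu ^ 2) * BesselI nu t ^ 2)
        by (unfold w; nra).
      assert (Hw : 0 < w).
      { unfold N in PN. fold w in PN. apply Rnot_le_lt. intros Hw. nra. }
      unfold N. fold w.
      replace (- (2 * (w ^ 2 + (t ^ 2 + nu ^ 2) * BesselI nu t ^ 2) / t)
                 / (2 * BesselI nu t * w) ^ 2 + / (t * BesselI nu t ^ 2))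
        with ((w ^ 2 - (t ^ 2 + nu ^ 2) * BesselI nu t ^ 2)
              / (2 * t * BesselI nu t ^ 2 * w ^ 2))
        by (field; repeat split; lra).
      apply Rle_div_l; [|lra].
      repeat apply Rmult_lt_0_compat; try apply pow_lt; lra.
  - replace (Finite 0) with (Rbar_opp 0) by (simpl; f_equal; ring).
    apply is_lim_opp. now apply is_lim_besselRho.
  - intros t Ht. assert (0 < / N t) by (apply Rinv_0_lt_compat, HN; lra). lra.
Qed.

(** The derivative of the difference has the sign opposite to [(t + s)^2 - (t + t^2 + nu^2) = (2 s -
    1) t + s^2 - nu^2]; both conditions on [s] are read off from this expression. *)
Lemma besselRho_lower (nu s x : R) : 0 <= nu -> nu <= s -> 1 / 2 <= s -> 0 < x ->
  wronskian_const nu <> 0 ->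
  / (BesselI nu x * (nu * BesselI nu x + x * BesselI (nu + 1) x
                     + (x + s) * BesselI nu x))
  <= besselRho nu x.
Proof.
  intros Hnu Hs Hs2 Hx Hc. apply Rminus_le_0.
  set (N := fun t => BesselI nu t * (nu * BesselI nu t + t * BesselI (nu + 1) t
                                     + (t + s) * BesselI nu t)).
  assert (HN : forall t, 0 < t -> t * BesselI nu t ^ 2 <= N t /\ 0 < N t).
  { intros t Ht. unfold N.
    assert (P := BesselI_pos nu t ltac:(lra) Ht).
    assert (P1 := BesselI_pos (nu + 1) t ltac:(lra) Ht).
    assert (0 < t * BesselI (nu + 1) t) by now apply Rmult_lt_0_compat.
    assert (0 < t * BesselI nu t) by now apply Rmult_lt_0_compat.
    split.
    - replace (t * BesselI nu t ^ 2) with (BesselI nu t * (t * BesselI nu t))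
        by ring.
      apply Rmult_le_compat_l; nra.
    - apply Rmult_lt_0_compat; nra. }
  (* The minorant uses [N t >= t * I(t)^2 >= t * I(1)^2] for [t > 1]. *)
  apply (nonincreasing_lim_nonneg (fun t => besselRho nu t - / N t)
           (fun t => besselRho nu t - / BesselI nu 1 ^ 2 / t)); try easy.
  - apply nonincreasing_of_derive with
      (fun t => - / (t * BesselI nu t ^ 2)
        + (((nu * BesselI nu t + t * BesselI (nu + 1) t) ^ 2
            + 2 * (t + s) * (nu * BesselI nu t + t * BesselI (nu + 1) t)
              * BesselI nu t
            + (t + t ^ 2 + nu ^ 2) * BesselI nu t ^ 2) / t) / N t ^ 2).
    + intros t Ht.
      assert (D := is_derive_BesselI nu t Ht).
      assert (D1 := is_derive_BesselI_succ nu t Ht).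
      assert (DR := is_derive_besselRho nu t ltac:(lra) Ht Hc).
      destruct (HN t Ht) as [_ PN].
      assert (P := BesselI_pos nu t ltac:(lra) Ht).
      unfold N in *. auto_derive.
      * repeat split; try (eexists; eassumption). lra.
      * replace (Derive (fun x => BesselI nu x) t)
          with (nu / t * BesselI nu t + BesselI (nu + 1) t)
          by (symmetry; now apply is_derive_unique).
        replace (Derive (fun x => BesselI (nu + 1) x) t)
          with (BesselI nu t - (nu + 1) / t * BesselI (nu + 1) t)
          by (symmetry; now apply is_derive_unique).
        replace (Derive (fun x => besselRho nu x) t)
          with (- / (t * BesselI nu t ^ 2))
          by (symmetry; now apply is_derive_unique).
        field. repeat split; try lra. intros Z. rewrite Z in PN. lra.
    + intros t Ht.
      assert (P := BesselI_pos nu t ltac:(lra) Ht).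
      destruct (HN t Ht) as [_ PN].
      unfold N in *.
      set (w := nu * BesselI nu t + t * BesselI (nu + 1) t) in *.
      set (b := BesselI nu t) in *.
      assert (Hw : 0 < w + (t + s) * b) by (apply Rnot_le_lt; intros Hw; nra).
      replace (- / (t * b ^ 2)
         + (w ^ 2 + 2 * (t + s) * w * b + (t + t ^ 2 + nu ^ 2) * b ^ 2) / t
           / (b * (w + (t + s) * b)) ^ 2)
        with (- ((t + s) ^ 2 - (t + t ^ 2 + nu ^ 2)) / (t * (w + (t + s) * b) ^ 2))
        by (field; repeat split; lra).
      apply Rle_div_l.
      * apply Rmult_lt_0_compat; [easy | now apply pow_lt].
      * nra.
  - replace (Finite 0) with (Finite (0 - 0)) by (f_equal; ring).
    apply is_lim_minus'; [now apply is_lim_besselRho|].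
    apply is_lim_const_div_infty.
  - intros t Ht. destruct (HN t ltac:(lra)) as [L PN].
    apply Rplus_le_compat_l, Ropp_le_contravar.
    assert (P := BesselI_pos nu 1 ltac:(lra) Rlt_0_1).
    assert (M := BesselI_nondecreasing nu 1 t Hnu Rlt_0_1 ltac:(lra)).
    replace (/ BesselI nu 1 ^ 2 / t) with (/ (t * BesselI nu 1 ^ 2))
      by (field; lra).
    apply Rinv_le_contravar; [apply Rmult_lt_0_compat; nra|].
    apply Rle_trans with (2 := L). apply Rmult_le_compat_l; [lra|].
    apply pow_incr; lra.
Qed.

(** * The product of the two kinds for orders that are not integers *)

(* Equal to 1 by the reflection formula; periodicity and crude bounds suffice. *)
Definition kappa (nu : R) : R := PI / 2 * wronskian_const nu / sin (nu * PI).

(** Under a unit shift the sine and the Wronskian constant both change sign. *)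
Lemma kappa_succ (nu : R) : kappa (nu + 1) = kappa nu.
Proof.
  unfold kappa.
  replace ((nu + 1) * PI) with (nu * PI + PI) by ring. rewrite neg_sin.
  replace (wronskian_const (nu + 1)) with (- wronskian_const nu).
  - unfold Rdiv. rewrite Rinv_opp. ring.
  - unfold wronskian_const.
    rewrite (rGamma_rec (nu + 1)), (rGamma_rec (- (nu + 1))).
    replace (- (nu + 1) + 1) with (- nu) by ring. ring.
Qed.

Lemma kappa_add_nat (m : nat) (h : R) : kappa (INR m + h) = kappa h.
Proof.
  induction m as [|m IH].
  - simpl. f_equal. ring.
  - rewrite S_INR, <- IH, <- (kappa_succ (INR m + h)). f_equal. ring.
Qed.

(** The factor [h] extracted from [rGamma (- h)] cancels the zero of the sine at 0, leaving an
    expression that can be bounded for small [h]. *)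
Lemma kappa_eq (h : R) :
  kappa h = h * PI / sin (h * PI) * (rGamma (1 + h) * rGamma (1 - h)).
Proof.
  unfold kappa, wronskian_const. rewrite (rGamma_rec (- h)).
  replace (h + 1) with (1 + h) by ring. replace (- h + 1) with (1 - h) by ring.
  unfold Rdiv. set (i := / sin (h * PI)). field.
Qed.

Lemma kappa_pos (m : nat) (h : R) : 0 < h < 1 -> 0 < kappa (INR m + h).
Proof.
  intros Hh. rewrite kappa_add_nat, kappa_eq. assert (HP := PI_RGT_0).
  apply Rmult_lt_0_compat.
  - apply Rdiv_lt_0_compat; [nra|]. apply sin_gt_0; nra.
  - apply Rmult_lt_0_compat; apply rGamma_pos; lra.
Qed.

Lemma kappa_bounds (m : nat) (h : R) : 0 < h <= 1 / 4 ->
  1 / 2 <= kappa (INR m + h) <= 4.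
Proof.
  intros Hh. rewrite kappa_add_nat, kappa_eq.
  assert (HP := PI_RGT_0). assert (HP4 := PI_4).
  set (y := h * PI). assert (Hy : 0 < y <= 1) by (unfold y; nra).
  assert (S1 : sin y < y) by (apply sin_lt_x; lra).
  assert (S2 : y / 2 <= sin y).
  (* At index 0 the lower Taylor bound is [y - y^3 / 6]. *)
  { destruct (pre_sin_bound y 0 ltac:(lra) ltac:(lra)) as [B _].
    apply Rle_trans with (2 := B). unfold sin_approx, sin_term. simpl. nra. }
  assert (Q : 1 <= y / sin y <= 2).
  { split; [apply Rle_div_r | apply Rle_div_l]; lra. }
  assert (G1 := rGamma_ge_1 h ltac:(lra)).
  assert (G2 := rGamma_ge_1 (1 - h) ltac:(lra)).
  assert (E : rGamma (1 - h) = (1 - h) * rGamma (1 + (1 - h))).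
  { rewrite rGamma_rec at 1. f_equal. f_equal. ring. }
  assert (U1 : rGamma (1 + h) <= 1 + h).
  { assert (G := rGamma_log_convex (1 + h) (1 - h) ltac:(lra) ltac:(lra)).
    replace (1 + h + (1 - h)) with (1 + 1) in G by ring.
    assert (E2 := rGamma_rec 1). rewrite rGamma_1 in E2.
    apply Rle_trans with (1 := G). rewrite <- (Rmult_1_l (rGamma (1 + 1))), <- E2.
    rewrite Rmult_1_r. rewrite <- (Rpower_1 (1 + h)) at 2 by lra.
    apply Rle_Rpower; lra. }
  assert (U2 : rGamma (1 - h) <= 1).
  { assert (G := rGamma_log_convex (1 - h) h ltac:(lra) ltac:(lra)).
    replace (1 - h + h) with 1 in G by ring. rewrite rGamma_1 in G.
    apply Rle_trans with (1 := G). rewrite Rmult_1_r.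
    replace 1 with (Rpower 1 h) at 2
      by (unfold Rpower; rewrite ln_1, Rmult_0_r; apply exp_0).
    apply Rle_Rpower_l; lra. }
  assert (L2 : 3 / 4 <= rGamma (1 - h)) by nra.
  assert (3 / 4 <= rGamma (1 + h) * rGamma (1 - h) <= 2) by (split; nra).
  split; nra.
Qed.

Lemma wronskian_const_neq_0 (nu : R) : 0 < kappa nu -> wronskian_const nu <> 0.
Proof.
  intros H E. unfold kappa in H. rewrite E in H. unfold Rdiv in H. lra.
Qed.

Lemma BesselK_quot_eq (nu x : R) : -1 < nu -> 0 < x -> 0 < kappa nu ->
  BesselK_quot x nu = kappa nu * (BesselI nu x * besselRho nu x).
Proof.
  intros Hnu Hx Hk. assert (Hc := wronskian_const_neq_0 nu Hk).
  assert (P := BesselI_pos nu x Hnu Hx).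
  unfold BesselK_quot, kappa, besselRho, Rdiv. set (i := / sin (nu * PI)).
  field. split; lra || easy.
Qed.

Lemma besselRho_mul_le (nu x : R) : 0 <= nu -> 0 < x -> 0 < kappa nu ->
  2 * BesselI nu x * (nu * BesselI nu x + x * BesselI (nu + 1) x)
    * besselRho nu x <= 1.
Proof.
  intros Hnu Hx Hk.
  assert (U := besselRho_upper nu x Hnu Hx (wronskian_const_neq_0 nu Hk)).
  assert (P := BesselI_pos nu x ltac:(lra) Hx).
  assert (P1 := BesselI_pos (nu + 1) x ltac:(lra) Hx).
  set (N := 2 * BesselI nu x * (nu * BesselI nu x + x * BesselI (nu + 1) x)) in *.
  assert (HN : 0 < N).
  { unfold N. apply Rmult_lt_0_compat; [lra|].
    assert (0 < x * BesselI (nu + 1) x) by now apply Rmult_lt_0_compat. nra. }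
  rewrite <- (Rinv_r N) by lra. apply Rmult_le_compat_l; lra.
Qed.

Lemma besselRho_mul_ge (nu s x : R) :
  0 <= nu -> nu <= s -> 1 / 2 <= s -> 0 < x -> 0 < kappa nu ->
  1 <= BesselI nu x * (nu * BesselI nu x + x * BesselI (nu + 1) x
                       + (x + s) * BesselI nu x) * besselRho nu x.
Proof.
  intros Hnu Hs Hs2 Hx Hk.
  assert (U := besselRho_lower nu s x Hnu Hs Hs2 Hx (wronskian_const_neq_0 nu Hk)).
  assert (P := BesselI_pos nu x ltac:(lra) Hx).
  assert (P1 := BesselI_pos (nu + 1) x ltac:(lra) Hx).
  set (N := BesselI nu x * (nu * BesselI nu x + x * BesselI (nu + 1) x
                            + (x + s) * BesselI nu x)) in *.
  assert (HN : 0 < N).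
  { unfold N. apply Rmult_lt_0_compat; [lra|].
    assert (0 < x * BesselI (nu + 1) x) by now apply Rmult_lt_0_compat.
    assert (0 < (x + s) * BesselI nu x) by (apply Rmult_lt_0_compat; lra). nra. }
  rewrite <- (Rinv_r N) by lra. apply Rmult_le_compat_l; lra.
Qed.

Lemma besselRho_pos (nu x : R) : 0 <= nu -> 0 < x -> 0 < kappa nu ->
  0 < besselRho nu x.
Proof.
  intros Hnu Hx Hk.
  (* The choice [s = nu + 1 / 2] meets both conditions on [s] for every [nu >= 0]. *)
  assert (L := besselRho_mul_ge nu (nu + 1 / 2) x Hnu ltac:(lra) ltac:(lra) Hx Hk).
  assert (P := BesselI_pos nu x ltac:(lra) Hx).
  assert (P1 := BesselI_pos (nu + 1) x ltac:(lra) Hx).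
  assert (0 < x * BesselI (nu + 1) x) by now apply Rmult_lt_0_compat.
  assert (0 < (x + (nu + 1 / 2)) * BesselI nu x)
    by (apply Rmult_lt_0_compat; lra).
  assert (0 <= nu * BesselI nu x) by nra.
  assert (0 < BesselI nu x * (nu * BesselI nu x + x * BesselI (nu + 1) x
                       + (x + (nu + 1 / 2)) * BesselI nu x))
    by (apply Rmult_lt_0_compat; lra).
  apply Rnot_le_lt. intros Hr. nra.
Qed.

Lemma BesselK_quot_pos (nu x : R) : 0 <= nu -> 0 < x -> 0 < kappa nu ->
  0 < BesselK_quot x nu.
Proof.
  intros Hnu Hx Hk. rewrite BesselK_quot_eq by (try easy; lra).
  apply Rmult_lt_0_compat; [easy|].
  apply Rmult_lt_0_compat; [apply BesselI_pos; lra | now apply besselRho_pos].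
Qed.

(** The derivative of [I rho] is [(I w rho - 1) / (t I)], and the upper bound gives
    [I w rho <= 1/2]. Negative orders call for it, as the square of [K] appears there. *)
Lemma BesselK_quot_nonincreasing (nu x y : R) : 0 <= nu -> 0 < kappa nu ->
  0 < x -> x <= y -> BesselK_quot y nu <= BesselK_quot x nu.
Proof.
  intros Hnu Hk Hx Hxy. rewrite !BesselK_quot_eq by (try easy; lra).
  apply Rmult_le_compat_l; [lra|].
  apply (nonincreasing_of_derive (fun t => BesselI nu t * besselRho nu t)
    (fun t => (BesselI nu t * (nu * BesselI nu t + t * BesselI (nu + 1) t)
                * besselRho nu t - 1) / (t * BesselI nu t))); try easy.
  - intros t Ht.
    assert (D := is_derive_BesselI nu t Ht).
    assert (DR := is_derive_besselRho nu t ltac:(lra) Ht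
                    (wronskian_const_neq_0 nu Hk)).
    assert (P := BesselI_pos nu t ltac:(lra) Ht).
    auto_derive.
    + repeat split; eexists; eassumption.
    + replace (Derive (fun x => BesselI nu x) t)
        with (nu / t * BesselI nu t + BesselI (nu + 1) t)
        by (symmetry; now apply is_derive_unique).
      replace (Derive (fun x => besselRho nu x) t)
        with (- / (t * BesselI nu t ^ 2))
        by (symmetry; now apply is_derive_unique).
      field. lra.
  - intros t Ht. assert (U := besselRho_mul_le nu t Hnu Ht Hk).
    assert (P := BesselI_pos nu t ltac:(lra) Ht).
    apply Rle_div_l; [now apply Rmult_lt_0_compat | lra].
Qed.

Lemma BesselIK_quot_nonincreasing (nu x y : R) : 0 <= nu -> 0 < kappa nu ->
  0 < x -> x <= y ->
  BesselI nu y * BesselK_quot y nu <= BesselI nu x * BesselK_quot x nu.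
Proof.
  intros Hnu Hk Hx Hxy. rewrite !BesselK_quot_eq by (try easy; lra).
  apply (nonincreasing_of_derive
    (fun t => BesselI nu t * (kappa nu * (BesselI nu t * besselRho nu t)))
    (fun t => kappa nu * (2 * BesselI nu t
                * (nu * BesselI nu t + t * BesselI (nu + 1) t)
                * besselRho nu t - 1) / t)); try easy.
  - intros t Ht.
    assert (D := is_derive_BesselI nu t Ht).
    assert (DR := is_derive_besselRho nu t ltac:(lra) Ht
                    (wronskian_const_neq_0 nu Hk)).
    assert (P := BesselI_pos nu t ltac:(lra) Ht).
    auto_derive.
    + repeat split; eexists; eassumption.
    + replace (Derive (fun x => BesselI nu x) t)
        with (nu / t * BesselI nu t + BesselI (nu + 1) t)
        by (symmetry; now apply is_derive_unique).
      replace (Derive (fun x => besselRho nu x) t)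
        with (- / (t * BesselI nu t ^ 2))
        by (symmetry; now apply is_derive_unique).
      field. lra.
  - intros t Ht. assert (U := besselRho_mul_le nu t Hnu Ht Hk).
    apply Rle_div_l; [easy | nra].
Qed.

(** The derivative is nonnegative as soon as [I (2 w + t I) rho >= 1]. Because [w >= nu I], the
    factor [2 w + t I] is at least [w + (t + nu) I], so the lower bound with [s = nu] applies. *)
Lemma exp_BesselIK_quot_nondecreasing (nu x y : R) :
  1 / 2 <= nu -> 0 < kappa nu -> 0 < x -> x <= y ->
  exp x * (BesselI nu x * BesselK_quot x nu)
  <= exp y * (BesselI nu y * BesselK_quot y nu).
Proof.
  intros Hnu Hk Hx Hxy. rewrite !BesselK_quot_eq by (try easy; lra).
  apply Ropp_le_cancel.
  apply (nonincreasing_of_derive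
    (fun t => - (exp t * (BesselI nu t * (kappa nu
                   * (BesselI nu t * besselRho nu t)))))
    (fun t => exp t * kappa nu * (1 - BesselI nu t
        * (2 * (nu * BesselI nu t + t * BesselI (nu + 1) t) + t * BesselI nu t)
        * besselRho nu t) / t)); try easy.
  - intros t Ht.
    assert (D := is_derive_BesselI nu t Ht).
    assert (DR := is_derive_besselRho nu t ltac:(lra) Ht
                    (wronskian_const_neq_0 nu Hk)).
    assert (P := BesselI_pos nu t ltac:(lra) Ht).
    auto_derive.
    + repeat split; eexists; eassumption.
    + replace (Derive (fun x => BesselI nu x) t)
        with (nu / t * BesselI nu t + BesselI (nu + 1) t)
        by (symmetry; now apply is_derive_unique).
      replace (Derive (fun x => besselRho nu x) t)
        with (- / (t * BesselI nu t ^ 2))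
        by (symmetry; now apply is_derive_unique).
      field. lra.
  - intros t Ht.
    assert (U := besselRho_mul_ge nu nu t ltac:(lra) ltac:(lra) ltac:(lra) Ht Hk).
    assert (P := BesselI_pos nu t ltac:(lra) Ht).
    assert (P1 := BesselI_pos (nu + 1) t ltac:(lra) Ht).
    assert (R := besselRho_pos nu t ltac:(lra) Ht Hk).
    assert (X : 0 < exp t * kappa nu)
      by (apply Rmult_lt_0_compat; [apply exp_pos | easy]).
    assert (0 <= t * BesselI (nu + 1) t) by (apply Rmult_le_pos; lra).
    assert (0 <= BesselI nu t * (t * BesselI (nu + 1) t) * besselRho nu t)
      by (apply Rmult_le_pos; [apply Rmult_le_pos; lra | lra]).
    apply Rle_div_l; [easy|]. rewrite Rmult_0_l.
    rewrite <- (Rmult_0_r (exp t * kappa nu)).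
    apply Rmult_le_compat_l; [lra|]. nra.
Qed.

(** In the bounds on [rho], [J <= I] removes [J] from the lower one and
    [I <= (1 + 2 (nu + 1) / x) J] from the upper one. The resulting bounds are uniform for orders
    near an integer. *)
Lemma BesselIK_quot_bounds (nu x : R) : 0 <= nu -> 0 < x -> 0 < kappa nu ->
  kappa nu / (2 * nu + 1 / 2 + 2 * x) <= BesselI nu x * BesselK_quot x nu
  /\ BesselI nu x * BesselK_quot x nu
     <= kappa nu * (1 + 2 * (nu + 1) / x) / (2 * x).
Proof.
  intros Hnu Hx Hk. rewrite !BesselK_quot_eq by (try easy; lra).
  assert (P := BesselI_pos nu x ltac:(lra) Hx).
  assert (P1 := BesselI_pos (nu + 1) x ltac:(lra) Hx).
  assert (R := besselRho_pos nu x Hnu Hx Hk).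
  assert (U := besselRho_mul_le nu x Hnu Hx Hk).
  assert (L := besselRho_mul_ge nu (nu + 1 / 2) x Hnu ltac:(lra) ltac:(lra) Hx Hk).
  assert (B1 := BesselI_succ_le nu x Hnu Hx).
  assert (B2 := BesselI_le_succ nu x Hnu Hx).
  set (b := BesselI nu x) in *. set (j := BesselI (nu + 1) x) in *.
  set (r := besselRho nu x) in *.
  assert (Hbr : 0 < b * r) by now apply Rmult_lt_0_compat.
  split.
  - apply Rle_div_l; [lra|].
    replace (b * (kappa nu * (b * r)) * (2 * nu + 1 / 2 + 2 * x))
      with (kappa nu * (b * r * (b * (2 * nu + 1 / 2 + 2 * x)))) by ring.
    rewrite <- (Rmult_1_r (kappa nu)) at 1.
    apply Rmult_le_compat_l; [lra|]. apply Rle_trans with (1 := L).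
    replace (b * (nu * b + x * j + (x + (nu + 1 / 2)) * b) * r)
      with (b * r * (nu * b + x * j + (x + (nu + 1 / 2)) * b)) by ring.
    apply Rmult_le_compat_l; [lra|]. nra.
  - apply (Rle_div_r _ _ (2 * x)); [lra|].
    assert (0 < 2 * (nu + 1) / x) by (apply Rdiv_lt_0_compat; lra).
    replace (b * (kappa nu * (b * r)) * (2 * x))
      with (kappa nu * (b * r * (2 * x) * b)) by ring.
    apply Rmult_le_compat_l; [lra|].
    apply Rle_trans with (b * r * (2 * x) * ((1 + 2 * (nu + 1) / x) * j)).
    { apply Rmult_le_compat_l; [nra | easy]. }
    assert (b * r * (2 * x) * j <= 1).
    { apply Rle_trans with (2 := U).
      assert (0 <= b * r * (nu * b)) by (apply Rmult_le_pos; nra). lra. }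
    nra.
Qed.

(** * Integer orders *)

(* [BesselK] at an integer order is defined through [Lim], that is through
   [Lim_seq] along the orders [m + 1/(n+1)]; this is a well-defined number for
   any bounded sequence, and it preserves the inequalities below whether or not
   the sequence converges. *)
Definition approx_order (m n : nat) : R := INR m + / (INR n + 1).

(** Index 0 is excluded because it would give the integer order [m + 1]. *)
Lemma inv_succ_bounds (n : nat) : (1 <= n)%nat -> 0 < / (INR n + 1) < 1.
Proof.
  intros Hn. apply le_INR in Hn. simpl in Hn. split.
  - apply Rinv_0_lt_compat. lra.
  - rewrite <- Rinv_1. apply Rinv_lt_contravar; lra.
Qed.

Lemma kappa_approx_order_pos (m n : nat) : (1 <= n)%nat ->
  0 < kappa (approx_order m n).
Proof. intros Hn. now apply kappa_pos, inv_succ_bounds. Qed.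

Lemma approx_order_nonneg (m n : nat) : 0 <= approx_order m n.
Proof.
  unfold approx_order.
  assert (0 < / (INR n + 1))
    by (apply Rinv_0_lt_compat; generalize (pos_INR n); lra).
  generalize (pos_INR m). lra.
Qed.

Lemma BesselK_INR (m : nat) (x : R) :
  BesselK (INR m) x = real (Lim_seq (fun n => BesselK_quot x (approx_order m n))).
Proof.
  unfold BesselK. destruct (excluded_middle_informative _) as [|H]; [reflexivity|].
  exfalso. apply H. exists (Z.of_nat m). apply INR_IZR_INZ.
Qed.

Lemma BesselK_quot_approx_bounds (m : nat) (x : R) : 0 < x ->
  exists lo hi, 0 < lo /\
    eventually (fun n => lo <= BesselK_quot x (approx_order m n) <= hi).
Proof.
  intros Hx. assert (Hm := pos_INR m).
  assert (P := BesselI_pos (INR m) x ltac:(lra) Hx).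
  set (b := BesselI (INR m) x) in *.
  set (A := 1 + 2 / x). set (B := 1 + 2 * (INR m + 1) / x).
  assert (HA : 0 < 2 / x) by (apply Rdiv_lt_0_compat; lra).
  assert (HB : 0 < 2 * (INR m + 1) / x) by (apply Rdiv_lt_0_compat; lra).
  (* [p] and [s] are the bounds of [BesselIK_quot_bounds] with [kappa] replaced by 1/2 and 4, and
     the order by its largest value [m + 1]; [A] and [B] compare [I] at the nearby order with [I] at
     order [m]. *)
  set (p := 1 / 2 / (2 * (INR m + 1) + 1 / 2 + 2 * x)).
  set (s := 4 * (1 + 2 * (INR m + 2) / x) / (2 * x)).
  assert (Hp : 0 < p) by (apply Rdiv_lt_0_compat; lra).
  exists (p / (A * b)), (s * B / b). split.
  { apply Rdiv_lt_0_compat; [easy|]. apply Rmult_lt_0_compat; unfold A; lra. }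
  (* From index 3 on, [/ (INR n + 1) <= 1 / 4], as [kappa_bounds] requires. *)
  exists 3%nat. intros n Hn.
  destruct (inv_succ_bounds n ltac:(lia)) as [H0 H1].
  assert (H4 : / (INR n + 1) <= 1 / 4).
  { apply le_INR in Hn. simpl in Hn. unfold Rdiv. rewrite Rmult_1_l.
    apply Rinv_le_contravar; lra. }
  assert (Hnu := approx_order_nonneg m n).
  assert (Hk := kappa_approx_order_pos m n ltac:(lia)).
  destruct (kappa_bounds m (/ (INR n + 1)) ltac:(lra)) as [K1 K2].
  fold (approx_order m n) in K1, K2.
  destruct (BesselIK_quot_bounds _ x Hnu Hx Hk) as [L U].
  assert (Q := BesselK_quot_pos _ x Hnu Hx Hk).
  assert (I1 := BesselI_shift_le (INR m) (/ (INR n + 1)) x Hm ltac:(lra) Hx).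
  assert (I2 := BesselI_le_shift (INR m) (/ (INR n + 1)) x Hm ltac:(lra) Hx).
  fold (approx_order m n) in I1, I2. fold b in I1, I2.
  assert (PI' := BesselI_pos (approx_order m n) x ltac:(lra) Hx).
  set (c := BesselI (approx_order m n) x) in *.
  set (k := BesselK_quot x (approx_order m n)) in *.
  assert (Hi : 0 < / x) by now apply Rinv_0_lt_compat.
  assert (I1' : c <= A * b).
  { apply Rle_trans with (1 := I1). apply Rmult_le_compat_r; [lra|].
    unfold A, Rdiv. nra. }
  assert (I2' : b <= B * c).
  { apply Rle_trans with (1 := I2). apply Rmult_le_compat_r; [lra|].
    unfold B, Rdiv. apply Rplus_le_compat_l, Rmult_le_compat_r; [lra|]. nra. }
  assert (L' : p <= c * k).
  { apply Rle_trans with (2 := L). unfold p, Rdiv.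
    apply Rmult_le_compat; try lra.
    - apply Rlt_le, Rinv_0_lt_compat. lra.
    - apply Rinv_le_contravar; unfold approx_order in *; lra. }
  assert (U' : c * k <= s).
  { apply Rle_trans with (1 := U). unfold s, Rdiv at 1 3.
    apply Rmult_le_compat_r; [apply Rlt_le, Rinv_0_lt_compat; lra|].
    assert (0 < 2 * (approx_order m n + 1) / x) by (apply Rdiv_lt_0_compat; lra).
    apply Rmult_le_compat; try lra. apply Rplus_le_compat_l.
    unfold Rdiv. apply Rmult_le_compat_r; [lra|]. unfold approx_order. lra. }
  split.
  - apply Rle_div_l; [apply Rmult_lt_0_compat; unfold A; lra|]. nra.
  - apply (Rle_div_r _ _ b); [easy|].
    apply Rle_trans with (c * k * B); [nra|].
    apply Rmult_le_compat_r; [unfold B; lra | easy].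
Qed.

(** The bounds [lo] and [hi] pass to [Lim_seq], so it is finite and [real] returns its true value
    rather than the default 0. *)
Lemma BesselK_INR_pos_lim (m : nat) (x : R) : 0 < x ->
  0 < BesselK (INR m) x /\
  Lim_seq (fun n => BesselK_quot x (approx_order m n)) = BesselK (INR m) x.
Proof.
  intros Hx. rewrite BesselK_INR.
  destruct (BesselK_quot_approx_bounds m x Hx) as [lo [hi [Hlo H]]].
  set (u := fun n => BesselK_quot x (approx_order m n)) in *.
  assert (L : Rbar_le (Finite lo) (Lim_seq u)).
  { rewrite <- (Lim_seq_const lo). apply Lim_seq_le_loc.
    apply filter_imp with (2 := H). now intros n [? _]. }
  assert (U : Rbar_le (Lim_seq u) (Finite hi)).
  { rewrite <- (Lim_seq_const hi). apply Lim_seq_le_loc.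
    apply filter_imp with (2 := H). now intros n [_ ?]. }
  destruct (Lim_seq u) as [l| |]; try easy.
  simpl in *. split; [lra | easy].
Qed.

Lemma le_of_forall_slack (a b : R) : 0 <= b ->
  (forall e, 0 < e -> a <= (1 + e) * b) -> a <= b.
Proof.
  intros Hb H. apply Rnot_lt_le. intros Hlt.
  assert (He : 0 < (a - b) / (2 * (b + 1))) by (apply Rdiv_lt_0_compat; lra).
  assert (K := H _ He).
  assert (E : (a - b) / (2 * (b + 1)) * (2 * (b + 1)) = a - b) by (field; lra).
  nra.
Qed.

(** [Lim_seq] is monotone and lets constants through, so the varying factor [I] is first replaced by
    its value at order [m]. This costs the factor [g n], which tends to 1 and is absorbed in
    [1 + e]. The constant [c] is 1 for the product itself and [exp (y - x)] for its exponential
    multiple. *)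
Lemma BesselIK_INR_le (m : nat) (x y c : R) : 0 < x -> 0 < y -> 0 < c ->
  (forall n, (1 <= n)%nat ->
     BesselI (approx_order m n) y * BesselK_quot y (approx_order m n)
     <= c * (BesselI (approx_order m n) x * BesselK_quot x (approx_order m n))) ->
  BesselI (INR m) y * BesselK (INR m) y
  <= c * (BesselI (INR m) x * BesselK (INR m) x).
Proof.
  intros Hx Hy Hc H. assert (Hm := pos_INR m).
  destruct (BesselK_INR_pos_lim m x Hx) as [Kx Lx].
  destruct (BesselK_INR_pos_lim m y Hy) as [Ky Ly].
  assert (Ix := BesselI_pos (INR m) x ltac:(lra) Hx).
  assert (Iy := BesselI_pos (INR m) y ltac:(lra) Hy).
  apply le_of_forall_slack.
  { apply Rmult_le_pos; [lra | nra]. }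
  intros e He.
  set (g := fun n : nat => (1 + 2 * (INR m + 1) / y * / (INR n + 1))
                           * (1 + 2 / x * / (INR n + 1))).
  assert (Hg : is_lim_seq g 1).
  { replace (Finite 1) with
      (Finite ((1 + 2 * (INR m + 1) / y * 0) * (1 + 2 / x * 0))) by (f_equal; ring).
    assert (Hh : is_lim_seq (fun n => / (INR n + 1)) 0).
    { apply is_lim_seq_ext with (fun n => / INR (S n)).
      { intros n. now rewrite S_INR. }
      replace (Finite 0) with (Rbar_inv p_infty) by easy.
      apply is_lim_seq_inv; [|easy].
      apply -> is_lim_seq_incr_1. apply is_lim_seq_INR. }
    apply is_lim_seq_mult'; apply is_lim_seq_plus'; try apply is_lim_seq_const;
      (apply is_lim_seq_mult'; [apply is_lim_seq_const | exact Hh]). }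
  apply is_lim_seq_spec in Hg. destruct (Hg (mkposreal e He)) as [N HN].
  simpl in HN.
  assert (K : Rbar_le
    (Lim_seq (fun n => BesselI (INR m) y * BesselK_quot y (approx_order m n)))
    (Lim_seq (fun n => (1 + e) * (c * BesselI (INR m) x)
                       * BesselK_quot x (approx_order m n)))).
  { apply Lim_seq_le_loc. exists (S N). intros n Hn.
    assert (Gn := HN n ltac:(lia)). apply Rabs_def2 in Gn. destruct Gn as [Gn _].
    assert (Hn1 : (1 <= n)%nat) by lia. specialize (H n Hn1).
    destruct (inv_succ_bounds n Hn1) as [H0 H1].
    assert (Hnu := approx_order_nonneg m n).
    assert (Hk := kappa_approx_order_pos m n Hn1).
    assert (Qx := BesselK_quot_pos _ x Hnu Hx Hk).
    assert (Qy := BesselK_quot_pos _ y Hnu Hy Hk).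
    assert (I1 := BesselI_shift_le (INR m) (/ (INR n + 1)) x Hm ltac:(lra) Hx).
    assert (I2 := BesselI_le_shift (INR m) (/ (INR n + 1)) y Hm ltac:(lra) Hy).
    fold (approx_order m n) in I1, I2.
    set (h := / (INR n + 1)) in *.
    set (nu := approx_order m n) in *.
    assert (HA : 0 < 1 + 2 * h * (INR m + 1) / y).
    { assert (0 < 2 * h * (INR m + 1) / y)
        by (apply Rdiv_lt_0_compat; [apply Rmult_lt_0_compat|]; lra). lra. }
    apply Rle_trans with
      ((1 + 2 * h * (INR m + 1) / y) * (BesselI nu y * BesselK_quot y nu)); [nra|].
    apply Rle_trans with
      ((1 + 2 * h * (INR m + 1) / y) *
       (c * ((1 + 2 * h / x) * BesselI (INR m) x * BesselK_quot x nu))).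
    { apply Rmult_le_compat_l; [lra|]. apply Rle_trans with (1 := H).
      apply Rmult_le_compat_l; [lra|]. apply Rmult_le_compat_r; lra. }
    assert (G : (1 + 2 * h * (INR m + 1) / y) * (1 + 2 * h / x) <= 1 + e).
    { replace ((1 + 2 * h * (INR m + 1) / y) * (1 + 2 * h / x)) with (g n)
        by (unfold g; fold h; field; lra). lra. }
    assert (0 < c * BesselI (INR m) x * BesselK_quot x nu)
      by (apply Rmult_lt_0_compat; [now apply Rmult_lt_0_compat | exact Qx]).
    nra. }
  rewrite !Lim_seq_scal_l, Lx, Ly in K. simpl in K. lra.
Qed.

(** * Monotonicity of the product *)

(** Collects what the study of [q] requires, so that integer, positive and negative orders are told
    apart only once. *)
Record bessel_product_shape (nu : R) : Prop := {
  shape_pos : forall x, 0 < x -> 0 < BesselI nu x * BesselK nu x;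
  shape_nonincreasing : forall x y, 0 < x -> x <= y ->
    BesselI nu y * BesselK nu y <= BesselI nu x * BesselK nu x;
  shape_exp_nondecreasing : 1 / 2 <= nu -> forall x y, 0 < x -> x <= y ->
    exp x * (BesselI nu x * BesselK nu x) <= exp y * (BesselI nu y * BesselK nu y)
}.

Lemma bessel_product_shape_INR (m : nat) : bessel_product_shape (INR m).
Proof.
  assert (Hm := pos_INR m). split.
  - intros x Hx. apply Rmult_lt_0_compat; [apply BesselI_pos; lra|].
    now apply BesselK_INR_pos_lim.
  - intros x y Hx Hxy. rewrite <- (Rmult_1_l (_ * BesselK _ x)).
    apply BesselIK_INR_le; try lra. intros n Hn. rewrite Rmult_1_l.
    apply BesselIK_quot_nonincreasing; try easy.
    + apply approx_order_nonneg.
    + now apply kappa_approx_order_pos.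
  - intros H2 x y Hx Hxy.
    assert (E : exp y = exp x * exp (y - x))
      by (rewrite <- exp_plus; f_equal; ring).
    rewrite E, Rmult_assoc.
    apply Rmult_le_compat_l; [apply Rlt_le, exp_pos|].
    apply BesselIK_INR_le; try lra; [apply exp_pos|]. intros n Hn.
    apply Rmult_le_reg_l with (exp x); [apply exp_pos|].
    rewrite <- (Rmult_assoc (exp x) (exp (y - x))), <- E.
    apply exp_BesselIK_quot_nondecreasing; try easy.
    + unfold approx_order. generalize (inv_succ_bounds n Hn). lra.
    + now apply kappa_approx_order_pos.
Qed.

Lemma BesselK_not_int (nu x : R) : ~ (exists m : Z, nu = IZR m) ->
  BesselK nu x = BesselK_quot x nu.
Proof.
  intros H. unfold BesselK.
  now destruct (excluded_middle_informative _) as [?|].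
Qed.

Lemma kappa_pos_not_int (nu : R) : 0 < nu -> ~ (exists m : Z, nu = IZR m) ->
  0 < kappa nu.
Proof.
  intros Hnu H. destruct (nfloor_ex nu (Rlt_le _ _ Hnu)) as [m [H1 H2]].
  replace nu with (INR m + (nu - INR m)) by ring. apply kappa_pos.
  enough (nu <> INR m) by lra. intros E. apply H. exists (Z.of_nat m).
  now rewrite <- INR_IZR_INZ.
Qed.

Lemma bessel_product_shape_pos (nu : R) : 0 < nu ->
  ~ (exists m : Z, nu = IZR m) -> bessel_product_shape nu.
Proof.
  intros Hnu Hi. assert (Hk := kappa_pos_not_int nu Hnu Hi).
  split; intros; rewrite !BesselK_not_int by easy.
  - apply Rmult_lt_0_compat; [apply BesselI_pos; lra|].
    apply BesselK_quot_pos; lra.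
  - apply BesselIK_quot_nonincreasing; lra.
  - apply exp_BesselIK_quot_nondecreasing; lra.
Qed.

(** Numerator and sine are both odd in the order. *)
Lemma BesselK_quot_opp (nu x : R) : BesselK_quot x (- nu) = BesselK_quot x nu.
Proof.
  unfold BesselK_quot. rewrite Ropp_involutive, Ropp_mult_distr_l_reverse, sin_neg.
  unfold Rdiv. rewrite Rinv_opp. ring.
Qed.

(* [I_{-a} = I_a + (2/pi) sin(a pi) K_a], so that the product at order [-a] is
   [I_a K_a] plus a positive multiple of [K_a^2]. *)
Lemma bessel_product_shape_neg (nu : R) : -1 < nu < 0 -> bessel_product_shape nu.
Proof.
  intros Hnu.
  assert (Hi : ~ (exists m : Z, nu = IZR m)).
  { intros [m ->]. destruct Hnu as [H1 H2].
    apply lt_IZR in H1, H2. lia. }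
  set (a := - nu). assert (Ha : 0 < a < 1) by (unfold a; lra).
  assert (Hk : 0 < kappa a).
  { replace a with (INR 0 + a) by (simpl; ring). now apply kappa_pos. }
  assert (HP := PI_RGT_0).
  assert (Hs : 0 < sin (a * PI)) by (apply sin_gt_0; nra).
  assert (Hd : 0 < 2 / PI * sin (a * PI)).
  { apply Rmult_lt_0_compat; [apply Rdiv_lt_0_compat; lra | easy]. }
  assert (E : forall x, BesselI nu x * BesselK nu x =
    BesselI a x * BesselK_quot x a
    + 2 / PI * sin (a * PI) * (BesselK_quot x a * BesselK_quot x a)).
  { intros x. rewrite BesselK_not_int by easy.
    replace nu with (- a) by (unfold a; ring). rewrite BesselK_quot_opp.
    replace (BesselI (- a) x)
      with (BesselI a x + 2 / PI * sin (a * PI) * BesselK_quot x a); [ring|].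
    unfold BesselK_quot. field. lra. }
  split.
  - intros x Hx. rewrite E.
    assert (Q := BesselK_quot_pos a x ltac:(lra) Hx Hk).
    assert (P := BesselI_pos a x ltac:(lra) Hx).
    apply Rplus_lt_0_compat; [nra|]. apply Rmult_lt_0_compat; [easy | nra].
  - intros x y Hx Hxy. rewrite !E.
    apply Rplus_le_compat; [apply BesselIK_quot_nonincreasing; lra|].
    apply Rmult_le_compat_l; [lra|].
    assert (Q := BesselK_quot_pos a y ltac:(lra) ltac:(lra) Hk).
    assert (L := BesselK_quot_nonincreasing a x y ltac:(lra) Hk Hx Hxy).
    apply Rmult_le_compat; lra.
  - lra.
Qed.

Lemma bessel_product_shape_all (nu : R) : -1 < nu -> bessel_product_shape nu.
Proof.
  intros Hnu. destruct (excluded_middle_informative (exists m : Z, nu = IZR m))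
    as [[m ->] | Hi].
  - assert (Hm : (0 <= m)%Z) by (apply lt_IZR in Hnu; lia).
    rewrite <- (Z2Nat.id m Hm), <- INR_IZR_INZ. apply bessel_product_shape_INR.
  - destruct (Rlt_dec nu 0); [apply bessel_product_shape_neg; lra|].
    apply bessel_product_shape_pos; [|easy].
    enough (nu <> 0) by lra. intros ->. apply Hi. now exists 0%Z.
Qed.

(** * Monotonicity of [q] *)

(** The derivative is negative by the strict inequality [1 + ln (1 / c) < 1 / c] for [c < 1]. This
    is the source of strictness on (0, 1], as [exp x * I K] is only known to be nondecreasing. *)
Lemma exp_mul_one_minus_ln_decreasing (x y : R) : 0 < x -> x < y -> y <= 1 ->
  exp y * (1 - ln y) < exp x * (1 - ln x).
Proof.
  intros Hx Hxy Hy.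
  destruct (MVT_cor2 (fun t => exp t * (1 - ln t))
              (fun t => exp t * (1 - ln t - / t)) x y Hxy) as [c [E Hc]].
  - intros t Ht. apply is_derive_Reals. auto_derive; [lra|]. field. lra.
  - assert (L : 1 - ln c - / c < 0).
    { assert (K := exp_ineq1 (ln (/ c))). rewrite exp_ln, ln_Rinv in K.
      - enough (- ln c <> 0) by lra.
        generalize (ln_increasing c 1 ltac:(lra) ltac:(lra)). rewrite ln_1. lra.
      - lra.
      - apply Rinv_0_lt_compat. lra. }
    assert (0 < exp c) by apply exp_pos.
    assert (exp c * (1 - ln c - / c) < 0) by nra. nra.
Qed.

Theorem theorem5 (nu : R) (hnu : -1 < nu) :
  (forall x : R, 0 < x -> 0 < q nu x) /\
  (1 / 2 <= nu ->
     forall x y : R, 0 < x -> x < y -> y <= 1 -> q nu x < q nu y) /\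
  (forall x y : R, 1 <= x -> x < y -> q nu y < q nu x) /\
  q nu 1 = BesselI nu 1 * BesselK nu 1 /\
  (1 / 2 <= nu -> forall x : R, 0 < x <= 1 -> q nu x <= q nu 1) /\
  (forall x : R, 1 <= x -> q nu x <= q nu 1).
Proof.
  destruct (bessel_product_shape_all nu hnu) as [Pos Dec Inc].
  assert (Hinc : 1 / 2 <= nu ->
     forall x y : R, 0 < x -> x < y -> y <= 1 -> q nu x < q nu y).
  { intros H2 x y Hx Hxy Hy. unfold q.
    assert (Ly : ln y <= 0) by (rewrite <- ln_1; apply ln_le; lra).
    assert (Lx : ln x < ln y) by (apply ln_increasing; lra).
    rewrite !Rabs_left1 by lra.
    assert (I := Inc H2 x y Hx ltac:(lra)).
    assert (D := exp_mul_one_minus_ln_decreasing x y Hx Hxy Hy).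
    assert (Px := Pos x Hx). assert (Py := Pos y ltac:(lra)).
    assert (Ex := exp_pos x). assert (Ey := exp_pos y).
    set (a := BesselI nu x * BesselK nu x) in *.
    set (b := BesselI nu y * BesselK nu y) in *.
    apply (Rlt_div_l a _ (1 + - ln x)); [lra|].
    replace (b / (1 + - ln y) * (1 + - ln x))
      with (b * (1 + - ln x) / (1 + - ln y)) by (field; lra).
    apply (Rlt_div_r _ _ (1 + - ln y)); [lra|].
    apply Rmult_lt_reg_l with (exp x); [easy|].
    (* The chain is [exp x * a * (1 - ln y) <= exp y * b * (1 - ln y) < exp x * b * (1 - ln x)]. *)
    apply Rle_lt_trans with (exp y * b * (1 + - ln y)); nra. }
  assert (Hdec : forall x y : R, 1 <= x -> x < y -> q nu y < q nu x).
  { intros x y Hx Hxy. unfold q.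
    assert (Lx : 0 <= ln x) by (rewrite <- ln_1; apply ln_le; lra).
    assert (Ly : ln x < ln y) by (apply ln_increasing; lra).
    rewrite !Rabs_pos_eq by lra.
    assert (I := Dec x y ltac:(lra) ltac:(lra)).
    assert (Py := Pos y ltac:(lra)).
    (* The product contributes a weak inequality; strictness comes from the denominator [1 + ln]. *)
    unfold Rdiv. apply Rle_lt_trans with
      (BesselI nu x * BesselK nu x * / (1 + ln y)).
    - apply Rmult_le_compat_r; [apply Rlt_le, Rinv_0_lt_compat; lra | easy].
    - apply Rmult_lt_compat_l; [lra|]. apply Rinv_lt_contravar; nra. }
  split; [|split; [easy|split; [easy|split; [|split]]]].
  - intros x Hx. unfold q. apply Rdiv_lt_0_compat; [now apply Pos|].
    generalize (Rabs_pos (ln x)). lra.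
  - unfold q. rewrite ln_1, Rabs_R0. field.
  - intros H2 x [Hx [H1 | ->]]; [|apply Rle_refl].
    apply Rlt_le, Hinc; lra.
  - intros x [H1 | <-]; [|apply Rle_refl].
    apply Rlt_le, Hdec; lra.
Qed.
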